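(* Let $(a,b)\in\mathcal E$. For any two distinct regular Weierstrass points of $L_{a,b}$ there is a cylinder in $L_{a,b}$ whose core curve passes through these two points.
   Context: $\mathcal E=\{(a,b)\in(0,1)^2:\ \frac1{1-a}=x+y\sqrt D,\ \frac1{1-b}=(1-x)+y\sqrt D,\ x,y\in\mathbb Q,\ D\in\mathbb Z_{>0}\}$. $L_{a,b}$ is the translation surface obtained from the flat torus $\mathbb R^2/\mathbb Z^2$ by removing the open rectangle $(0,a)\times(0,b)$ and identifying the two horizontal sides of the hole by a vertical translation and the two vertical sides by a horizontal translation; it lies in $\mathcal H(2)$ (genus 2, one zero, the image of the rectangle's corners). It is hyperelliptic, the hyperelliptic involution being induced by the rotation by $\pi$ about $(a/2,b/2)$. Its regular Weierstrass points are the five fixed points of this involution other than the zero. A cylinder is a maximal open annulus filled by parallel isotopic simple closed geodesics, isometric to $\mathbb R/w\mathbb Z\times(0,h)$; its core curve is the geodesic corresponding to $\mathbb R/w\mathbb Z\times\{h/2\}$. *)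

(* Defs.v *)
From Stdlib Require Import Reals Relations QArith Qreals ZArith.
Open Scope R_scope.

Definition pt := (R * R)%type.

Definition padd (p q : pt) : pt := (fst p + fst q, snd p + snd q).

Definition rot (c d : R) (v : pt) : pt :=
  (c * fst v - d * snd v, d * fst v + c * snd v).

(** Fundamental domain of L_{a,b}: the closed unit square minus the open
    rectangle (0,a)x(0,b), taken as the closure of its interior,
    i.e. ([a,1]x[0,1]) u ([0,a]x[b,1]). *)
Definition inL (a b : R) (p : pt) : Prop :=
  0 <= fst p <= 1 /\ 0 <= snd p <= 1 /\ (a <= fst p \/ b <= snd p).

(** Edge identifications: those of the torus R^2/Z^2 and those of the
    sides of the hole (vertical sides by a horizontal translation,
    horizontal sides by a vertical translation). *)
Inductive glue (a b : R) : pt -> pt -> Prop :=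
| glue_left_right : forall y, b <= y <= 1 -> glue a b (0, y) (1, y)
| glue_hole_vert  : forall y, 0 <= y <= b -> glue a b (a, y) (1, y)
| glue_bot_top    : forall x, a <= x <= 1 -> glue a b (x, 0) (x, 1)
| glue_hole_horiz : forall x, 0 <= x <= a -> glue a b (x, b) (x, 1).

Definition same_pt (a b : R) : pt -> pt -> Prop :=
  clos_refl_sym_trans pt (glue a b).

(** The zero of L_{a,b} (image of the corners of the rectangle). *)
Definition singular (a b : R) (p : pt) : Prop := same_pt a b p (a, b).

(** p is fixed by the hyperelliptic involution, induced by the rotation
    by pi about (a/2,b/2) (on the torus: x |-> (a,b) - x mod Z^2). *)
Definition hyp_fixed (a b : R) (p : pt) : Prop :=
  exists q : pt, inL a b q /\
    (exists m n : Z, fst q = a - fst p + IZR m /\ snd q = b - snd p + IZR n) /\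
    same_pt a b q p.

Definition regular_weierstrass (a b : R) (p : pt) : Prop :=
  inL a b p /\ ~ singular a b p /\ hyp_fixed a b p.

(** F : R x (0,h) -> L_{a,b} is a flat cylinder of circumference w,
    height h, direction (c,d): a w-periodic embedding of R/wZ x (0,h)
    which is locally a translation after rotation by (c,d), avoiding the
    zero. *)
Definition is_flat_cyl (a b : R) (w h c d : R) (F : R -> R -> pt) : Prop :=
  0 < w /\ 0 < h /\ c ^ 2 + d ^ 2 = 1 /\
  (forall s t, 0 < t < h -> inL a b (F s t) /\ ~ singular a b (F s t)) /\
  (forall s t, 0 < t < h -> same_pt a b (F (s + w) t) (F s t)) /\
  (forall s t s' t', 0 < t < h -> 0 < t' < h ->
     same_pt a b (F s t) (F s' t') ->
     t = t' /\ exists k : Z, s' = s + IZR k * w) /\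
  (forall s t, 0 < t < h -> exists r, 0 < r /\
     forall ds dt, ds ^ 2 + dt ^ 2 < r ^ 2 -> 0 < t + dt < h ->
       exists x : pt, inL a b x /\ same_pt a b x (F s t) /\
         inL a b (padd x (rot c d (ds, dt))) /\
         same_pt a b (F (s + ds) (t + dt)) (padd x (rot c d (ds, dt)))).

Definition cyl_sub (a b : R) (F : R -> R -> pt) (h : R) (G : R -> R -> pt) (h' : R) : Prop :=
  forall s t, 0 < t < h -> exists s' t', 0 < t' < h' /\ same_pt a b (G s' t') (F s t).

Definition cylinder (a b : R) (w h c d : R) (F : R -> R -> pt) : Prop :=
  is_flat_cyl a b w h c d F /\
  forall w' h' c' d' G, is_flat_cyl a b w' h' c' d' G ->
    cyl_sub a b F h G h' -> cyl_sub a b G h' F h.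

Definition core_through (a b : R) (h : R) (F : R -> R -> pt) (p : pt) : Prop :=
  exists s, same_pt a b (F s (h / 2)) p.

Definition in_E (a b : R) : Prop :=
  0 < a < 1 /\ 0 < b < 1 /\
  exists (x y : Q) (D : Z), (0 < D)%Z /\
    1 / (1 - a) = Q2R x + Q2R y * sqrt (IZR D) /\
    1 / (1 - b) = (1 - Q2R x) + Q2R y * sqrt (IZR D).

(* Main.v *)
Require Import Defs.
From Stdlib Require Import Reals Relations QArith Qreals ZArith.
From Stdlib Require Import Lra Lia List.
Open Scope R_scope.

(** A straight segment joining two regular Weierstrass points and its image under
    the involution form a closed geodesic through both points, and the maximal
    strip of parallel geodesics around it is a cylinder of which it is the core
    curve; so it suffices to find, for each pair, such a segment avoiding the
    singularity. Two pairs are joined by a horizontal and by a vertical core curve. For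
    the others one lets the geodesic wind an arbitrary number of times around
    the vertical cylinders over [0, a] and [a, 1]: each further pair of turns
    around the first one moves the height at which it crosses [x = a] by less
    than the length [1 - b] of the interval it has to hit, so some winding number
    works. The reflection exchanging the coordinates, and [a] with [b], provides
    the remaining pairs. *)

(** Points are taken up to the closure of [glue], and a priori nothing bounds how far this closure
    reaches. The invariant [sing_fun] settles it: it detects the singularity, and where it is
    positive two equivalent points are equal or differ by a single gluing. Maximality of a cylinder
    quantifies over all flat cylinders containing it. It is replaced by a checkable criterion: both
    boundary circles must approach the singularity. For the strips used here both boundaries are
    reached at the same distance, because the involution exchanges the two sides of the geodesic;
    hence the geodesic is the core. Parity ties winding numbers to Weierstrass points. Two of them
    lie at abscissa [a / 2], and the parity of the number of turns around the cylinder over [[0, a]]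
    decides which one the geodesic meets. So turns may only be added in pairs, and the shift caused
    by two turns must still be shorter than the target interval: it is [(1 - a) * (1 - b)] with two
    crossings and [2 * (1 - a) / (2 - a) * (1 - b)] with three, both below [1 - b]. *)

Lemma same_pt_refl (a b : R) (p : pt) : same_pt a b p p.
Proof. apply rst_refl. Qed.

Lemma same_pt_sym (a b : R) (p q : pt) : same_pt a b p q -> same_pt a b q p.
Proof. apply rst_sym. Qed.

Lemma same_pt_trans (a b : R) (p q r : pt) :
  same_pt a b p q -> same_pt a b q r -> same_pt a b p r.
Proof. apply rst_trans. Qed.

Lemma glue_same_pt (a b : R) (p q : pt) : glue a b p q -> same_pt a b p q.
Proof. apply rst_step. Qed.

(** * The singularity and the gluing relation *)

Definition cubic (c x : R) : R := x * (x - c) * (x - 1).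

(** Since [cubic c] vanishes at [0], [c] and [1], this function takes equal
    values at glued points; on the surface its only zero is the singularity. *)
Definition sing_fun (a b : R) (p : pt) : R :=
  cubic a (fst p) ^ 2 + cubic b (snd p) ^ 2.

Lemma glue_sing_fun (a b : R) (p q : pt) :
  glue a b p q -> sing_fun a b p = sing_fun a b q.
Proof. intros []; unfold sing_fun, cubic; simpl; ring. Qed.

Lemma same_pt_sing_fun (a b : R) (p q : pt) :
  same_pt a b p q -> sing_fun a b p = sing_fun a b q.
Proof. induction 1; auto using glue_sing_fun; congruence. Qed.

Lemma sing_fun_nonneg (a b : R) (p : pt) : 0 <= sing_fun a b p.
Proof. unfold sing_fun; nra. Qed.

Lemma cubic_eq_0 (c x : R) : cubic c x = 0 -> x = 0 \/ x = c \/ x = 1.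
Proof.
  unfold cubic; intros H.
  destruct (Rmult_integral _ _ H) as [H1|H1]; [|lra].
  destruct (Rmult_integral _ _ H1); lra.
Qed.

Lemma cubic_neq_0 (c x : R) : x <> 0 -> x <> c -> x <> 1 -> 0 < cubic c x ^ 2.
Proof.
  intros; assert (cubic c x <> 0) by (intros E; destruct (cubic_eq_0 _ _ E); lra).
  nra.
Qed.

Lemma sing_fun_pos_fst (a b : R) (p : pt) :
  fst p <> 0 -> fst p <> a -> fst p <> 1 -> 0 < sing_fun a b p.
Proof.
  intros; unfold sing_fun; pose proof (cubic_neq_0 a (fst p)); nra.
Qed.

Lemma sing_fun_pos_snd (a b : R) (p : pt) :
  snd p <> 0 -> snd p <> b -> snd p <> 1 -> 0 < sing_fun a b p.
Proof.
  intros; unfold sing_fun; pose proof (cubic_neq_0 b (snd p)); nra.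
Qed.

Lemma singular_sing_fun (a b : R) (p : pt) : singular a b p -> sing_fun a b p = 0.
Proof.
  intros H; rewrite (same_pt_sing_fun _ _ _ _ H).
  unfold sing_fun, cubic; simpl; ring.
Qed.

Lemma sing_fun_eq_0 (a b : R) (p : pt) : sing_fun a b p = 0 ->
  (fst p = 0 \/ fst p = a \/ fst p = 1) /\ (snd p = 0 \/ snd p = b \/ snd p = 1).
Proof.
  unfold sing_fun; intros H.
  split; apply cubic_eq_0; nra.
Qed.

(** Of the nine candidate zeros the origin lies outside the domain, since [a] and [b] are positive;
    a chain of gluings around the corners identifies the other eight. *)
Lemma sing_fun_singular (a b : R) (p : pt) : 0 < a < 1 -> 0 < b < 1 ->
  inL a b p -> sing_fun a b p = 0 -> singular a b p.
Proof.
  intros Ha Hb (Hx & Hy & Hxy) H; unfold singular.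
  destruct p as [x y]; apply sing_fun_eq_0 in H; simpl in *.
  assert (A1 : same_pt a b (a, 1) (1, 1)).
  { apply same_pt_trans with (a, b);
      [apply same_pt_sym, glue_same_pt, glue_hole_horiz; lra|].
    apply same_pt_trans with (1, b); [apply glue_same_pt, glue_hole_vert; lra|].
    apply same_pt_trans with (0, b);
      [apply same_pt_sym, glue_same_pt, glue_left_right; lra|].
    apply same_pt_trans with (0, 1); [apply glue_same_pt, glue_hole_horiz; lra|].
    apply glue_same_pt, glue_left_right; lra. }
  assert (AB : same_pt a b (a, 1) (a, b))
    by (apply same_pt_sym, glue_same_pt, glue_hole_horiz; lra).
  assert (B1 : same_pt a b (1, b) (a, b))
    by (apply same_pt_sym, glue_same_pt, glue_hole_vert; lra).
  assert (B0 : same_pt a b (0, b) (a, b)).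
  { eapply same_pt_trans; [|exact B1]; apply glue_same_pt, glue_left_right; lra. }
  assert (O1 : same_pt a b (1, 1) (a, b))
    by (eapply same_pt_trans; [apply same_pt_sym, A1 | exact AB]).
  destruct H as [[-> | [-> | ->]] [-> | [-> | ->]]]; auto; try lra.
  - eapply same_pt_trans; [|exact O1]; apply glue_same_pt, glue_left_right; lra.
  - eapply same_pt_trans; [|exact AB]; apply glue_same_pt, glue_bot_top; lra.
  - apply same_pt_refl.
  - eapply same_pt_trans; [|exact O1]; apply glue_same_pt, glue_bot_top; lra.
Qed.

Lemma nonsingular_pos (a b : R) (p : pt) : 0 < a < 1 -> 0 < b < 1 ->
  inL a b p -> ~ singular a b p -> 0 < sing_fun a b p.
Proof.
  intros Ha Hb Hp Hs.
  destruct (Rle_lt_or_eq_dec _ _ (sing_fun_nonneg a b p)) as [|E]; auto.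
  exfalso; apply Hs, sing_fun_singular; auto.
Qed.

Lemma pos_nonsingular (a b : R) (p : pt) :
  0 < sing_fun a b p -> ~ singular a b p.
Proof. intros H Hs; apply singular_sing_fun in Hs; lra. Qed.

(** Two gluings can be composed non-trivially only at a corner. [D], [S] and [T] check this for a
    chain, for a common source and for a common target, so away from the singularity the closure
    collapses to one step. *)
Lemma same_pt_cases (a b : R) (p q : pt) : 0 < a < 1 -> 0 < b < 1 ->
  same_pt a b p q -> 0 < sing_fun a b p ->
  p = q \/ glue a b p q \/ glue a b q p.
Proof.
  intros Ha Hb.
  assert (D : forall x y z, glue a b x y -> glue a b y z -> sing_fun a b y = 0).
  { intros x y z H1 H2.
    inversion H1; subst; inversion H2; subst; unfold sing_fun, cubic; simpl; try lra; try nra. }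
  assert (S : forall x y z, glue a b x y -> glue a b x z -> y = z \/ sing_fun a b x = 0).
  { intros x y z H1 H2.
    inversion H1; subst; inversion H2; subst; try (left; f_equal; lra);
      right; unfold sing_fun, cubic; simpl; try lra; try nra. }
  assert (T : forall x y z, glue a b x y -> glue a b z y -> x = z \/ sing_fun a b y = 0).
  { intros x y z H1 H2.
    inversion H1; subst; inversion H2; subst; try (left; f_equal; lra);
      right; unfold sing_fun, cubic; simpl;
      match goal with
      | H1 : b <= ?u <= 1, H2 : 0 <= ?u <= b |- _ => replace u with b by lra
      | H1 : a <= ?u <= 1, H2 : 0 <= ?u <= a |- _ => replace u with a by lra
      | _ => idtac
      end;
      lra. }
  induction 1 as [x y H|x|x y H IH|x y z H1 IH1 H2 IH2]; intros Hf; auto.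
  - rewrite (same_pt_sing_fun _ _ _ _ H) in IH.
    destruct (IH Hf) as [|[|]]; auto.
  - pose proof (same_pt_sing_fun _ _ _ _ H1) as E.
    rewrite <- E in IH2.
    destruct (IH1 Hf) as [-> | [G1|G1]]; auto;
      destruct (IH2 Hf) as [<- | [G2|G2]]; auto.
    + pose proof (D _ _ _ G1 G2); lra.
    + destruct (T _ _ _ G1 G2); [auto|lra].
    + destruct (S _ _ _ G1 G2); [auto|lra].
    + pose proof (D _ _ _ G2 G1); lra.
Qed.

(** * Real induction, and displacements near a regular point *)

Lemma interval_induction (S : R) (P : R -> Prop) : 0 <= S -> P 0 ->
  (forall x, 0 <= x < S -> P x ->
     exists e, 0 < e /\ forall y, x < y < x + e -> y <= S -> P y) ->
  (forall x, 0 < x <= S -> (forall y, 0 <= y < x -> P y) -> P x) ->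
  forall x, 0 <= x <= S -> P x.
Proof.
  intros HS P0 Hopen Hclosed.
  set (E := fun x => 0 <= x <= S /\ forall y, 0 <= y <= x -> P y).
  assert (E0 : E 0).
  { split; [lra|]; intros y Hy; replace y with 0 by lra; auto. }
  destruct (completeness E) as [m [Hub Hlub]].
  { exists S; intros x [Hx _]; lra. }
  { exists 0; auto. }
  assert (m0 : 0 <= m) by (apply Hub; auto).
  assert (mS : m <= S) by (apply Hlub; intros x [Hx _]; lra).
  assert (Hlt : forall y, 0 <= y < m -> P y).
  { intros y Hy.
    destruct (Classical_Prop.classic (P y)) as [|N]; auto.
    exfalso; enough (m <= y) by lra.
    apply Hlub; intros x [Hx Hxy].
    destruct (Rle_lt_dec x y); auto.
    exfalso; apply N, Hxy; lra. }
  assert (Pm : P m).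
  { destruct (Req_dec m 0) as [->|]; auto; apply Hclosed; auto; lra. }
  destruct (Rle_lt_dec S m) as [HSm|HSm].
  - intros x Hx; destruct (Req_dec x m) as [->|]; auto; apply Hlt; lra.
  - exfalso; destruct (Hopen m) as (e & He & Hnext); auto; try lra.
    pose proof (Rmin_l e (S - m)); pose proof (Rmin_r e (S - m)).
    assert (0 < Rmin e (S - m)) by (apply Rmin_glb_lt; lra).
    assert (m + Rmin e (S - m) / 2 <= m); [|lra].
    apply Hub; split; [lra|].
    intros y Hy; destruct (Rlt_le_dec y m); [apply Hlt; lra|].
    destruct (Req_dec y m) as [->|]; auto; apply Hnext; lra.
Qed.

(** A difference of squares is a sum times a difference. The sum has two terms and the divided
    difference of [cubic c] has three, all products of numbers of absolute value at most 1, whence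
    [6 = 2 * 3]. *)
Lemma cubic_lipschitz (c x y : R) : 0 < c < 1 -> 0 <= x <= 1 -> 0 <= y <= 1 ->
  Rabs (cubic c x ^ 2 - cubic c y ^ 2) <= 6 * Rabs (x - y).
Proof.
  intros Hc Hx Hy; unfold cubic.
  replace ((x * (x - c) * (x - 1)) ^ 2 - (y * (y - c) * (y - 1)) ^ 2) with
    ((x * (x - c) * (x - 1) + y * (y - c) * (y - 1)) *
     ((x - c) * (x - 1) + y * (x - 1) + y * (y - c)) * (x - y)) by ring.
  rewrite Rabs_mult; apply Rmult_le_compat_r; [apply Rabs_pos|].
  assert (U : forall u v, Rabs u <= 1 -> Rabs v <= 1 -> Rabs (u * v) <= 1).
  { intros u v Hu Hv; rewrite Rabs_mult.
    pose proof (Rabs_pos u); pose proof (Rabs_pos v); nra. }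
  assert (B : forall z, 0 <= z <= 1 -> Rabs z <= 1 /\ Rabs (z - c) <= 1 /\ Rabs (z - 1) <= 1)
    by (intros z Hz; repeat split; apply Rabs_le; lra).
  destruct (B x Hx) as (X1 & X2 & X3), (B y Hy) as (Y1 & Y2 & Y3).
  rewrite Rabs_mult; replace 6 with (2 * 3) by ring.
  apply Rmult_le_compat; try apply Rabs_pos.
  - eapply Rle_trans; [apply Rabs_triang|].
    pose proof (U _ _ (U _ _ X1 X2) X3); pose proof (U _ _ (U _ _ Y1 Y2) Y3); lra.
  - eapply Rle_trans; [apply Rabs_triang|].
    eapply Rle_trans; [apply Rplus_le_compat_r, Rabs_triang|].
    pose proof (U _ _ X2 X3); pose proof (U _ _ Y1 X3); pose proof (U _ _ Y1 Y2); lra.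
Qed.

Lemma sing_fun_lipschitz (a b : R) (p q : pt) : 0 < a < 1 -> 0 < b < 1 ->
  inL a b p -> inL a b q ->
  Rabs (sing_fun a b p - sing_fun a b q) <=
    6 * (Rabs (fst p - fst q) + Rabs (snd p - snd q)).
Proof.
  intros Ha Hb (Hp1 & Hp2 & _) (Hq1 & Hq2 & _); unfold sing_fun.
  pose proof (cubic_lipschitz a _ _ Ha Hp1 Hq1).
  pose proof (cubic_lipschitz b _ _ Hb Hp2 Hq2).
  eapply Rle_trans; [|rewrite Rmult_plus_distr_l; apply Rplus_le_compat; eassumption].
  eapply Rle_trans; [|apply Rabs_triang]; right; f_equal; ring.
Qed.

Lemma cubic_dist (c x e : R) : 0 < c < 1 -> 0 <= x <= 1 -> 0 < e ->
  e ^ 2 <= cubic c x ^ 2 -> e <= Rabs x /\ e <= Rabs (x - c) /\ e <= Rabs (x - 1).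
Proof.
  intros Hc Hx He; unfold cubic; intros H.
  assert (H' : e <= Rabs x * Rabs (x - c) * Rabs (x - 1)).
  { rewrite <- !Rabs_mult, <- (Rabs_pos_eq e) by lra.
    apply Rsqr_le_abs_0; unfold Rsqr; lra. }
  assert (Rabs x <= 1 /\ Rabs (x - c) <= 1 /\ Rabs (x - 1) <= 1)
    by (repeat split; apply Rabs_le; lra).
  pose proof (Rabs_pos x); pose proof (Rabs_pos (x - c)); pose proof (Rabs_pos (x - 1)).
  assert (Rabs x * Rabs (x - c) <= Rabs x /\ Rabs x * Rabs (x - c) <= Rabs (x - c)
    /\ 0 <= Rabs x * Rabs (x - c)) by (repeat split; nra).
  repeat split; nra.
Qed.

(** The bound on [sing_fun] keeps [x] at distance at least [e] from the ends of its edge, so the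
    displaced points stay between them. As the surface lies on opposite sides of the two glued
    edges, both displaced points can be in the domain only if the displacement is along the edge. *)
Lemma glue_translate (a b e : R) (x y v : pt) : 0 < a < 1 -> 0 < b < 1 -> 0 < e ->
  glue a b x y -> e ^ 2 <= sing_fun a b x ->
  Rabs (fst v) < e -> Rabs (snd v) < e ->
  inL a b (padd x v) -> inL a b (padd y v) -> same_pt a b (padd x v) (padd y v).
Proof.
  intros Ha Hb He G; destruct v as [u v]; unfold sing_fun, inL, padd.
  assert (Z : forall c, cubic c 0 ^ 2 = 0 /\ cubic c c ^ 2 = 0)
    by (intros; unfold cubic; split; ring).
  destruct (Z a) as [Za0 Zaa], (Z b) as [Zb0 Zbb].
  destruct G as [z Hz|z Hz|z Hz|z Hz]; simpl fst; simpl snd;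
    rewrite ?Za0, ?Zaa, ?Zb0, ?Zbb, ?Rplus_0_l, ?Rplus_0_r;
    intros Hf Hu Hv Hx Hy; apply Rabs_def2 in Hu, Hv.
  - destruct (cubic_dist b z e) as (_ & D & _); auto; try lra.
    rewrite Rabs_pos_eq in D by lra.
    replace u with 0 by lra; rewrite Rplus_0_r.
    apply glue_same_pt, glue_left_right; lra.
  - destruct (cubic_dist b z e) as (D1 & D & _); auto; try lra.
    rewrite Rabs_left1 in D by lra; rewrite Rabs_pos_eq in D1 by lra.
    replace u with 0 by lra; rewrite !Rplus_0_r.
    apply glue_same_pt, glue_hole_vert; lra.
  - destruct (cubic_dist a z e) as (_ & D & _); auto; try lra.
    rewrite Rabs_pos_eq in D by lra.
    replace v with 0 by lra; rewrite Rplus_0_r.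
    apply glue_same_pt, glue_bot_top; lra.
  - destruct (cubic_dist a z e) as (D1 & D & _); auto; try lra.
    rewrite Rabs_left1 in D by lra; rewrite Rabs_pos_eq in D1 by lra.
    replace v with 0 by lra; rewrite !Rplus_0_r.
    apply glue_same_pt, glue_hole_horiz; lra.
Qed.

Lemma same_pt_translate (a b e : R) (x y v : pt) : 0 < a < 1 -> 0 < b < 1 -> 0 < e ->
  same_pt a b x y -> e ^ 2 <= sing_fun a b x ->
  Rabs (fst v) < e -> Rabs (snd v) < e ->
  inL a b (padd x v) -> inL a b (padd y v) -> same_pt a b (padd x v) (padd y v).
Proof.
  intros Ha Hb He S Hf Hu Hv Hx Hy.
  destruct (same_pt_cases a b x y) as [->|[G|G]]; auto; [nra|apply same_pt_refl| |].
  - eapply glue_translate; eauto.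
  - apply same_pt_sym; eapply glue_translate; eauto.
    rewrite <- (same_pt_sing_fun _ _ _ _ S); auto.
Qed.

Lemma abs_lt_of_sq_sum (x y e : R) : 0 < e -> x ^ 2 + y ^ 2 < e ^ 2 ->
  Rabs x < e /\ Rabs y < e.
Proof. intros; split; apply Rabs_def1; nra. Qed.

Lemma Rmult_small (q e : R) : 0 < e ->
  exists d, 0 < d /\ forall x, Rabs x < d -> Rabs (x * q) < e.
Proof.
  intros He; exists (e / (Rabs q + 1)); pose proof (Rabs_pos q).
  split; [apply Rdiv_lt_0_compat; lra|].
  intros x Hx; rewrite Rabs_mult.
  apply Rmult_lt_compat_r with (r := Rabs q + 1) in Hx; [|lra].
  unfold Rdiv in Hx; rewrite Rmult_assoc, Rinv_l, Rmult_1_r in Hx by lra.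
  pose proof (Rabs_pos x); nra.
Qed.

Lemma segment_small (x y t q h e : R) : 0 < e -> 0 < t < h ->
  exists d, 0 < d /\ forall z, Rabs z < d ->
    (z * x) ^ 2 + (z * y) ^ 2 < e ^ 2 /\ 0 < t + z * q < h.
Proof.
  intros He Ht.
  destruct (Rmult_small x (e / 2)) as (d1 & Hd1 & H1); [lra|].
  destruct (Rmult_small y (e / 2)) as (d2 & Hd2 & H2); [lra|].
  destruct (Rmult_small q (Rmin t (h - t))) as (d3 & Hd3 & H3); [apply Rmin_glb_lt; lra|].
  exists (Rmin d1 (Rmin d2 d3)); split; [repeat apply Rmin_glb_lt; auto|].
  intros z Hz; apply Rmin_Rgt_l in Hz as [Hz1 Hz]; apply Rmin_Rgt_l in Hz as [Hz2 Hz3].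
  specialize (H1 z Hz1); specialize (H2 z Hz2); specialize (H3 z Hz3).
  apply Rmin_Rgt_l in H3 as [H3 H4]; apply Rgt_lt, Rabs_def2 in H3, H4.
  apply Rabs_def2 in H1, H2; split; [nra|lra].
Qed.

(** * Overlapping flat cylinders and a criterion for maximality *)

(** [u] and [v] are the cosine and sine of the angle from the direction of [G] to that of [F]: near
    a common point the change of coordinates is this rotation followed by a translation. *)
Lemma flat_transition (a b w h c d w' h' c' d' : R) (F G : R -> R -> pt) (s t s' t' : R) :
  0 < a < 1 -> 0 < b < 1 ->
  is_flat_cyl a b w h c d F -> is_flat_cyl a b w' h' c' d' G ->
  0 < t < h -> 0 < t' < h' -> same_pt a b (F s t) (G s' t') ->
  let u := c * c' + d * d' in let v := c' * d - d' * c in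
  exists e, 0 < e /\ forall x y, x ^ 2 + y ^ 2 < e ^ 2 ->
    0 < t + y < h -> 0 < t' + (v * x + u * y) < h' ->
    same_pt a b (F (s + x) (t + y)) (G (s' + (u * x - v * y)) (t' + (v * x + u * y))).
Proof.
  intros Ha Hb (_ & _ & Hcd & FL & _ & _ & Floc) (_ & _ & Hcd' & _ & _ & _ & Gloc)
    Ht Ht' HFG u v.
  destruct (Floc s t Ht) as (r1 & Hr1 & H1), (Gloc s' t' Ht') as (r2 & Hr2 & H2).
  destruct (FL s t Ht) as [FLin FLn].
  pose proof (nonsingular_pos _ _ _ Ha Hb FLin FLn) as Hf.
  pose proof (sqrt_lt_R0 _ Hf) as He.
  set (e := sqrt (sing_fun a b (F s t))) in *.
  assert (Ee : e ^ 2 = sing_fun a b (F s t)) by (apply pow2_sqrt; lra).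
  exists (Rmin r1 (Rmin r2 e)); split; [repeat apply Rmin_glb_lt; auto|].
  intros x y Hxy Hy Hy'.
  assert (M : forall m, 0 < m -> Rmin r1 (Rmin r2 e) <= m -> x ^ 2 + y ^ 2 < m ^ 2).
  { intros m Hm Hle.
    assert (0 < Rmin r1 (Rmin r2 e)) by (repeat apply Rmin_glb_lt; auto).
    assert ((Rmin r1 (Rmin r2 e)) ^ 2 <= m ^ 2) by (apply pow_incr; lra); lra. }
  pose proof (Rmin_l r1 (Rmin r2 e)); pose proof (Rmin_r r1 (Rmin r2 e)).
  pose proof (Rmin_l r2 e); pose proof (Rmin_r r2 e).
  assert (N : (u * x - v * y) ^ 2 + (v * x + u * y) ^ 2 = x ^ 2 + y ^ 2).
  { replace (_ + _) with ((c ^ 2 + d ^ 2) * (c' ^ 2 + d' ^ 2) * (x ^ 2 + y ^ 2))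
      by (unfold u, v; ring).
    rewrite Hcd, Hcd'; ring. }
  destruct (H1 x y) as (p & Lp & Ep & Lpv & Epv); [apply M; lra|auto|].
  destruct (H2 (u * x - v * y) (v * x + u * y)) as (q & Lq & Eq & Lqv & Eqv);
    [rewrite N; apply M; lra|auto|].
  assert (V : rot c' d' (u * x - v * y, v * x + u * y) = rot c d (x, y)).
  { unfold rot; simpl; f_equal.
    - transitivity ((c' ^ 2 + d' ^ 2) * (c * x - d * y)); [unfold u, v; ring|].
      rewrite Hcd'; ring.
    - transitivity ((c' ^ 2 + d' ^ 2) * (d * x + c * y)); [unfold u, v; ring|].
      rewrite Hcd'; ring. }
  rewrite V in *.
  eapply same_pt_trans; [exact Epv|].
  eapply same_pt_trans; [|apply same_pt_sym; exact Eqv].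
  assert (S : same_pt a b p q).
  { eapply same_pt_trans; [exact Ep|]; eapply same_pt_trans; [exact HFG|].
    apply same_pt_sym; auto. }
  destruct (abs_lt_of_sq_sum (c * x - d * y) (d * x + c * y) e) as [B1 B2]; auto.
  { replace ((c * x - d * y) ^ 2 + (d * x + c * y) ^ 2)
      with ((c ^ 2 + d ^ 2) * (x ^ 2 + y ^ 2)) by ring.
    rewrite Hcd, Rmult_1_l; apply M; lra. }
  apply same_pt_translate with e; auto.
  rewrite Ee, (same_pt_sing_fun _ _ _ _ Ep); lra.
Qed.

(** Real induction along the segment. The inclusion of [F] in [G] is what keeps the segment from
    running into the boundary of [G]. *)
Lemma flat_continuation (a b w h c d w' h' c' d' : R) (F G : R -> R -> pt)
    (s t s' t' x y : R) :
  0 < a < 1 -> 0 < b < 1 ->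
  is_flat_cyl a b w h c d F -> is_flat_cyl a b w' h' c' d' G ->
  cyl_sub a b F h G h' ->
  0 < t < h -> 0 < t + y < h -> 0 < t' < h' -> same_pt a b (F s t) (G s' t') ->
  let u := c * c' + d * d' in let v := c' * d - d' * c in
  0 < t' + (v * x + u * y) < h' /\
  same_pt a b (F (s + x) (t + y)) (G (s' + (u * x - v * y)) (t' + (v * x + u * y))).
Proof.
  intros Ha Hb HF HG Hsub Ht Hty Ht' HFG u v.
  set (p := u * x - v * y); set (q := v * x + u * y).
  set (P := fun z => 0 < t' + z * q < h' /\
    same_pt a b (F (s + z * x) (t + z * y)) (G (s' + z * p) (t' + z * q))).
  assert (Hin : forall z, 0 <= z <= 1 -> 0 < t + z * y < h)
    by (intros; destruct (Rle_lt_dec 0 y); nra).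
  enough (P1 : P 1) by (unfold P in P1; rewrite !Rmult_1_l in P1; exact P1).
  apply interval_induction with (S := 1); try lra.
  - unfold P; rewrite !Rmult_0_l, !Rplus_0_r; auto.
  - intros z Hz [Hz1 Hz2].
    destruct (flat_transition a b _ _ _ _ _ _ _ _ F G _ _ _ _ Ha Hb HF HG
      (Hin z ltac:(lra)) Hz1 Hz2) as (e & He & Htr).
    destruct (segment_small x y _ q _ e He Hz1) as (dl & Hdl & Hsm).
    exists dl; split; auto; intros z' Hz' Hz'1.
    destruct (Hsm (z' - z)) as [Hs1 Hs2]; [apply Rabs_def1; lra|].
    assert (Eq : t' + z * q + (z' - z) * q = t' + z' * q) by ring.
    split; [lra|].
    specialize (Htr ((z' - z) * x) ((z' - z) * y) Hs1).
    replace (s + z * x + (z' - z) * x) with (s + z' * x) in Htr by ring.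
    replace (t + z * y + (z' - z) * y) with (t + z' * y) in Htr by ring.
    fold u v in Htr.
    replace (t' + z * q + (v * ((z' - z) * x) + u * ((z' - z) * y)))
      with (t' + z' * q) in Htr by (unfold q; ring).
    replace (s' + z * p + (u * ((z' - z) * x) - v * ((z' - z) * y)))
      with (s' + z' * p) in Htr by (unfold p; ring).
    apply Htr; [apply Hin; lra|lra].
  - intros z Hz Hprev.
    (* The inclusion gives coordinates [(s2, t2)] of the limit point, a priori unrelated to the
       expected ones. Going back from them to an earlier parameter [z'], where the coordinates are
       known, injectivity of [G] shows that they agree up to a multiple of the period. *)
    destruct (Hsub (s + z * x) (t + z * y)) as (s2 & t2 & Ht2 & H2); [apply Hin; lra|].
    apply same_pt_sym in H2.
    destruct (flat_transition a b _ _ _ _ _ _ _ _ F G _ _ _ _ Ha Hb HF HG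
      (Hin z ltac:(lra)) Ht2 H2) as (e & He & Htr).
    destruct (segment_small x y _ q _ e He Ht2) as (dl & Hdl & Hsm).
    set (z' := Rmax 0 (z - dl / 2)).
    assert (Hz' : 0 <= z' < z /\ z - z' < dl)
      by (unfold z'; apply Rmax_case_strong; lra).
    destruct (Hprev z') as [Hp1 Hp2]; [lra|].
    destruct (Hsm (z' - z)) as [Hs1 Hs2]; [apply Rabs_def1; lra|].
    specialize (Htr ((z' - z) * x) ((z' - z) * y) Hs1); fold u v in Htr.
    replace (s + z * x + (z' - z) * x) with (s + z' * x) in Htr by ring.
    replace (t + z * y + (z' - z) * y) with (t + z' * y) in Htr by ring.
    replace (v * ((z' - z) * x) + u * ((z' - z) * y))
      with ((z' - z) * q) in Htr by (unfold q; ring).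
    replace (u * ((z' - z) * x) - v * ((z' - z) * y))
      with ((z' - z) * p) in Htr by (unfold p; ring).
    specialize (Htr (Hin z' ltac:(lra)) Hs2).
    destruct HG as (_ & _ & _ & _ & Gper & Ginj & _).
    destruct (Ginj _ _ _ _ Hs2 Hp1
      (same_pt_trans _ _ _ _ _ (same_pt_sym _ _ _ _ Htr) Hp2)) as [E1 [k E2]].
    assert (E3 : t2 = t' + z * q) by lra.
    assert (E4 : s' + z * p = s2 + IZR k * w') by lra.
    split; [lra|].
    eapply same_pt_trans; [exact H2|]; rewrite E3, E4.
    assert (Gk : forall n s t, 0 < t < h' -> same_pt a b (G (s + INR n * w') t) (G s t)).
    { intros n s1 t1 Ht1; induction n as [|n IH].
      - simpl; rewrite Rmult_0_l, Rplus_0_r; apply same_pt_refl.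
      - eapply same_pt_trans; [|exact IH].
        rewrite S_INR; replace (s1 + (INR n + 1) * w') with (s1 + INR n * w' + w') by ring.
        apply Gper; auto. }
    rewrite E3 in Ht2.
    destruct (Z_le_gt_dec 0 k) as [Hk|Hk].
    + rewrite <- (Z2Nat.id k), <- INR_IZR_INZ by auto; apply same_pt_sym, Gk; auto.
    + replace s2 with (s2 + IZR k * w' + INR (Z.to_nat (- k)) * w') at 1; [apply Gk; auto|].
      rewrite INR_IZR_INZ, Z2Nat.id, opp_IZR by lia; ring.
Qed.

Lemma sing_fun_lower_bound (a b w h c d : R) (G : R -> R -> pt) (s0 t0 : R) :
  0 < a < 1 -> 0 < b < 1 -> is_flat_cyl a b w h c d G -> 0 < t0 < h ->
  exists e, 0 < e /\ forall s t, Rabs (s - s0) < e -> Rabs (t - t0) < e ->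
    0 < t < h -> e <= sing_fun a b (G s t).
Proof.
  intros Ha Hb (_ & _ & Hcd & GL & _ & _ & Gloc) Ht0.
  destruct (GL s0 t0 Ht0) as [Lin Ln].
  pose proof (nonsingular_pos _ _ _ Ha Hb Lin Ln) as Hf.
  destruct (Gloc s0 t0 Ht0) as (r & Hr & Hl).
  set (k := sing_fun a b (G s0 t0)) in *.
  (* The displacement has both coordinates below [2 * e], so [sing_fun] drops by at most
     [6 * (2 * e + 2 * e) = 24 * e]; the bound [k / 25] leaves at least [e]. *)
  exists (Rmin (r / 2) (k / 25)); set (e := Rmin _ _).
  assert (He : 0 < e) by (apply Rmin_glb_lt; lra).
  assert (Er : e <= r / 2) by apply Rmin_l; assert (Ek : e <= k / 25) by apply Rmin_r.
  split; auto; intros s t Hs Ht Hth.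
  assert (Q : (s - s0) ^ 2 + (t - t0) ^ 2 < 2 * e ^ 2)
    by (apply Rabs_def2 in Hs, Ht; nra).
  destruct (Hl (s - s0) (t - t0)) as (p & Lp & Ep & Lpv & Epv); [nra|lra|].
  replace (s0 + (s - s0)) with s in Epv by ring.
  replace (t0 + (t - t0)) with t in Epv by ring.
  rewrite (same_pt_sing_fun _ _ _ _ Epv).
  pose proof (sing_fun_lipschitz _ _ _ _ Ha Hb Lp Lpv) as Hlip.
  rewrite (same_pt_sing_fun _ _ _ _ Ep) in Hlip; fold k in Hlip.
  set (v := rot c d (s - s0, t - t0)) in *.
  assert (V : fst v ^ 2 + snd v ^ 2 < (2 * e) ^ 2).
  { unfold v, rot; simpl fst; simpl snd.
    replace (_ + _) with ((c ^ 2 + d ^ 2) * ((s - s0) ^ 2 + (t - t0) ^ 2)) by ring.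
    rewrite Hcd; nra. }
  destruct (abs_lt_of_sq_sum _ _ (2 * e) ltac:(lra) V) as [V1 V2].
  clearbody v; unfold padd in *; cbn [fst snd] in *.
  replace (fst p - (fst p + fst v)) with (- fst v) in Hlip by ring.
  replace (snd p - (snd p + snd v)) with (- snd v) in Hlip by ring.
  rewrite !Rabs_Ropp in Hlip.
  pose proof (Rle_abs (k - sing_fun a b (fst p + fst v, snd p + snd v))); lra.
Qed.

(** The boundary circles are not part of an open cylinder, so touching the singularity is expressed
    by interior points approaching height [t0] near a fixed abscissa. *)
Definition clusters_at_sing (a b h : R) (F : R -> R -> pt) (t0 : R) : Prop :=
  exists s0, forall e, 0 < e -> exists s t,
    Rabs (s - s0) < e /\ Rabs (t - t0) < e /\ 0 < t < h /\ sing_fun a b (F s t) < e.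

(** If a flat cylinder [G] contains [F], continuation along segments shows that
    [F] is [G] composed with a rigid motion preserving the circles; a circle of
    [G] outside [F] would force a limit point of [F] on the singularity into [G]. *)
Lemma cylinder_of_sing_clusters (a b w h c d : R) (F : R -> R -> pt) :
  0 < a < 1 -> 0 < b < 1 -> is_flat_cyl a b w h c d F ->
  clusters_at_sing a b h F 0 -> clusters_at_sing a b h F h ->
  cylinder a b w h c d F.
Proof.
  intros Ha Hb HF Hbot Htop; split; auto.
  intros w' h' c' d' G HG Hsub s' t' Ht'.
  pose proof HF as (_ & Hh & Hcd & _); pose proof HG as (_ & _ & Hcd' & _).
  destruct (Hsub 0 (h / 2)) as (s0 & t0 & Ht0 & E0); [lra|]; apply same_pt_sym in E0.
  set (u := c * c' + d * d'); set (v := c' * d - d' * c).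
  assert (Hcont : forall s t, 0 < t < h ->
    0 < t0 + (v * s + u * (t - h / 2)) < h' /\
    same_pt a b (F s t)
      (G (s0 + (u * s - v * (t - h / 2))) (t0 + (v * s + u * (t - h / 2))))).
  { intros s t Ht.
    pose proof (flat_continuation a b _ _ _ _ _ _ _ _ F G 0 (h / 2) s0 t0 s (t - h / 2)
      Ha Hb HF HG Hsub ltac:(lra) ltac:(lra) Ht0 E0) as H.
    rewrite Rplus_0_l in H; replace (h / 2 + (t - h / 2)) with t in H by ring; exact H. }
  (* If the directions were not parallel, following the middle circle of [F] for length [h' / v]
     would climb the whole height of [G]. *)
  assert (v0 : v = 0).
  { destruct (Req_dec v 0) as [|Hv]; auto; exfalso.
    destruct (Hcont (h' / v) (h / 2) ltac:(lra)) as [H _].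
    replace (v * (h' / v) + u * (h / 2 - h / 2)) with h' in H by (field; auto); lra. }
  assert (uu : u * u = 1).
  { transitivity ((c ^ 2 + d ^ 2) * (c' ^ 2 + d' ^ 2) - v ^ 2); [unfold u, v; ring|].
    rewrite Hcd, Hcd', v0; ring. }
  assert (Hcirc : forall s t, 0 < t < h ->
    same_pt a b (F s t) (G (s0 + u * s) (t0 + u * (t - h / 2)))).
  { intros s t Ht; destruct (Hcont s t Ht) as [_ H].
    rewrite v0, !Rmult_0_l, Rplus_0_l, Rminus_0_r in H; exact H. }
  assert (Hu : u = 1 \/ u = -1)
    by (assert ((u - 1) * (u + 1) = 0) as H by lra;
        apply Rmult_integral in H; lra).
  assert (Hau : Rabs u = 1)
    by (destruct Hu as [-> | ->]; [apply Rabs_R1|rewrite Rabs_left; lra]).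
  assert (Hedge : forall te, clusters_at_sing a b h F te ->
    0 < t0 + u * (te - h / 2) < h' -> False).
  { intros te [s1 Hs1] Hte.
    destruct (sing_fun_lower_bound a b _ _ _ _ G (s0 + u * s1) _ Ha Hb HG Hte)
      as (e & He & Hlow).
    destruct (Hs1 e He) as (s & t & Hs & Ht & Hth & Hsm).
    rewrite (same_pt_sing_fun _ _ _ _ (Hcirc s t Hth)) in Hsm.
    destruct (Hcont s t Hth) as [Hth' _]; rewrite v0, Rmult_0_l, Rplus_0_l in Hth'.
    enough (e <= sing_fun a b (G (s0 + u * s) (t0 + u * (t - h / 2)))) by lra.
    apply Hlow; auto.
    - replace (_ - _) with (u * (s - s1)) by ring; rewrite Rabs_mult, Hau, Rmult_1_l; auto.
    - replace (_ - _) with (u * (t - te)) by ring; rewrite Rabs_mult, Hau, Rmult_1_l; auto. }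
  set (t := h / 2 + u * (t' - t0)).
  destruct (Rle_lt_dec t 0) as [H0|H0].
  { exfalso; apply (Hedge 0 Hbot); unfold t in H0; destruct Hu as [E|E]; rewrite E in *; lra. }
  destruct (Rle_lt_dec h t) as [H1|H1].
  { exfalso; apply (Hedge h Htop); unfold t in H1; destruct Hu as [E|E]; rewrite E in *; lra. }
  exists (u * (s' - s0)), t; split; [lra|].
  eapply same_pt_trans; [apply Hcirc; lra|].
  replace (s0 + u * (u * (s' - s0))) with (s0 + (u * u) * (s' - s0)) by ring.
  replace (t0 + u * (t - h / 2)) with (t0 + (u * u) * (t' - t0)) by (unfold t; ring).
  rewrite uu, !Rmult_1_l.
  replace (s0 + (s' - s0)) with s' by ring; replace (t0 + (t' - t0)) with t' by ring.
  apply same_pt_refl.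
Qed.

(** * Reflection in the diagonal *)

Definition swap (p : pt) : pt := (snd p, fst p).

Lemma same_pt_swap (a b : R) (p q : pt) :
  same_pt a b p q -> same_pt b a (swap p) (swap q).
Proof.
  induction 1 as [? ? []| | |]; unfold swap; simpl.
  - apply glue_same_pt, glue_bot_top; auto.
  - apply glue_same_pt, glue_hole_horiz; auto.
  - apply glue_same_pt, glue_left_right; auto.
  - apply glue_same_pt, glue_hole_vert; auto.
  - apply same_pt_refl.
  - apply same_pt_sym; auto.
  - eapply same_pt_trans; eauto.
Qed.

Lemma swap_involutive (p : pt) : swap (swap p) = p.
Proof. destruct p; reflexivity. Qed.

Lemma inL_swap (a b : R) (p : pt) : inL a b p -> inL b a (swap p).
Proof. unfold inL, swap; simpl; tauto. Qed.

Lemma padd_rot_swap (c d x y : R) (p : pt) :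
  padd (swap p) (rot d c (x, y)) = swap (padd p (rot c d (x, - y))).
Proof. unfold padd, rot, swap; simpl; f_equal; ring. Qed.

(** The reflection reverses orientation; reversing [t] as well makes the local form a rotation
    again, now by [(d, c)]. *)
Definition swap_map (h : R) (F : R -> R -> pt) : R -> R -> pt :=
  fun s t => swap (F s (h - t)).

Lemma is_flat_cyl_swap (a b w h c d : R) (F : R -> R -> pt) :
  is_flat_cyl a b w h c d F -> is_flat_cyl b a w h d c (swap_map h F).
Proof.
  intros (Hw & Hh & Hcd & HL & Hper & Hinj & Hloc); unfold swap_map.
  split; [auto|]; split; [auto|]; split; [lra|]; split; [|split; [|split]].
  - intros s t Ht; destruct (HL s (h - t)) as [Lin N]; [lra|].
    split; [apply inL_swap; auto|].
    intros Hs; apply same_pt_swap in Hs; rewrite swap_involutive in Hs; apply N, Hs.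
  - intros s t Ht; apply same_pt_swap, Hper; lra.
  - intros s t s' t' Ht Ht' E; apply same_pt_swap in E; rewrite !swap_involutive in E.
    destruct (Hinj s (h - t) s' (h - t')) as [E1 E2]; auto; try lra.
    split; [lra|auto].
  - intros s t Ht; destruct (Hloc s (h - t)) as (r & Hr & H); [lra|].
    exists r; split; auto; intros x y Hxy Hy.
    destruct (H x (- y)) as (p & Lp & Ep & Lpv & Epv); [nra|lra|].
    exists (swap p); rewrite padd_rot_swap.
    split; [apply inL_swap; auto|]; split; [apply same_pt_swap; auto|].
    split; [apply inL_swap; auto|].
    replace (h - (t + y)) with (h - t + - y) by ring; apply same_pt_swap; auto.
Qed.

Lemma cyl_sub_swap (a b h h' : R) (F G : R -> R -> pt) :
  cyl_sub a b F h G h' -> cyl_sub b a (swap_map h F) h (swap_map h' G) h'.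
Proof.
  intros Hs s t Ht; destruct (Hs s (h - t)) as (s' & t' & Ht' & E); [lra|].
  exists s', (h' - t'); split; [lra|]; unfold swap_map.
  replace (h' - (h' - t')) with t' by ring; apply same_pt_swap; auto.
Qed.

Lemma swap_map_involutive (h s t : R) (F : R -> R -> pt) :
  swap_map h (swap_map h F) s t = F s t.
Proof.
  unfold swap_map; rewrite swap_involutive; f_equal; ring.
Qed.

Lemma cylinder_swap (a b w h c d : R) (F : R -> R -> pt) :
  cylinder a b w h c d F -> cylinder b a w h d c (swap_map h F).
Proof.
  intros [HF Hmax]; split; [apply is_flat_cyl_swap; auto|].
  intros w' h' c' d' G HG Hsub.
  apply is_flat_cyl_swap in HG; apply cyl_sub_swap in Hsub.
  assert (Hsub' : cyl_sub a b F h (swap_map h' G) h').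
  { intros s t Ht; destruct (Hsub s t Ht) as (s' & t' & Ht' & E).
    rewrite swap_map_involutive in E; eauto. }
  specialize (Hmax _ _ _ _ _ HG Hsub'); apply cyl_sub_swap in Hmax.
  intros s t Ht; destruct (Hmax s t Ht) as (s' & t' & Ht' & E).
  rewrite swap_map_involutive in E; eauto.
Qed.

Definition core_joined (a b : R) (p q : pt) : Prop :=
  exists (w h c d : R) (F : R -> R -> pt),
    cylinder a b w h c d F /\ core_through a b h F p /\ core_through a b h F q.

Lemma core_joined_sym (a b : R) (p q : pt) :
  core_joined a b p q -> core_joined a b q p.
Proof. intros (w & h & c & d & F & H1 & H2 & H3); exists w, h, c, d, F; auto. Qed.

Lemma core_joined_same_pt (a b : R) (p q p' q' : pt) :
  same_pt a b p p' -> same_pt a b q q' -> core_joined a b p q -> core_joined a b p' q'.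
Proof.
  intros Hp Hq (w & h & c & d & F & HF & [s Hs] & [s' Hs']).
  exists w, h, c, d, F; split; [|split]; auto;
    [exists s|exists s']; eapply same_pt_trans; eauto.
Qed.

Lemma core_joined_swap (a b : R) (p q : pt) :
  core_joined a b p q -> core_joined b a (swap p) (swap q).
Proof.
  intros (w & h & c & d & F & HF & [s Hs] & [s' Hs']).
  exists w, h, d, c, (swap_map h F); split; [apply cylinder_swap; auto|].
  unfold core_through, swap_map; replace (h - h / 2) with (h / 2) by field.
  split; [exists s|exists s']; apply same_pt_swap; auto.
Qed.

(** * Charts unrolling the vertical cylinders *)

Lemma Int_part_unique (x : R) (k : Z) : IZR k <= x < IZR k + 1 -> Int_part x = k.
Proof.
  intros H; destruct (base_Int_part x) as [H1 H2].
  assert (k < Int_part x + 1)%Z by (apply lt_IZR; rewrite plus_IZR; lra).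
  assert (Int_part x < k + 1)%Z by (apply lt_IZR; rewrite plus_IZR; lra).
  lia.
Qed.

Definition pmod (m x : R) : R := x - m * IZR (Int_part (x / m)).

Lemma pmod_range (m x : R) : 0 < m -> 0 <= pmod m x < m.
Proof.
  intros Hm; unfold pmod; destruct (base_Int_part (x / m)) as [H1 H2].
  set (k := IZR (Int_part _)) in *.
  assert (E : m * (x / m - k) = x - m * k) by (field; apply Rgt_not_eq; lra); rewrite <- E.
  set (q := x / m - k) in *; assert (0 <= q < 1) by (unfold q; lra).
  clearbody q; split; nra.
Qed.

Lemma pmod_unique (m x y : R) (k : Z) :
  0 <= y < m -> x = y + m * IZR k -> pmod m x = y.
Proof.
  intros Hy ->; unfold pmod.
  rewrite (Int_part_unique _ k); [ring|].
  assert (E : (y + m * IZR k) / m = IZR k + y / m) by (field; apply Rgt_not_eq; lra).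
  assert (Hq : 0 <= y / m < 1).
  { split; [apply Rle_mult_inv_pos; lra|].
    apply Rmult_lt_reg_r with m; [lra|]; unfold Rdiv.
    rewrite Rmult_assoc, Rinv_l by (apply Rgt_not_eq; lra); lra. }
  rewrite E; lra.
Qed.

(** Unrolls a vertical cylinder: the one over [a <= x <= 1] for [beta = 0], the
    one over [0 <= x <= a] for [beta = b]. *)
Definition chart (beta x y : R) : pt := (x, beta + pmod (1 - beta) (y - beta)).

Lemma chart_eq (beta x y z : R) (k : Z) :
  beta <= z < 1 -> y = z + (1 - beta) * IZR k -> chart beta x y = (x, z).
Proof.
  intros Hz ->; unfold chart; f_equal.
  rewrite (pmod_unique _ _ (z - beta) k); [ring|lra|ring].
Qed.

Lemma chart_range (beta x y : R) :
  beta < 1 -> fst (chart beta x y) = x /\ beta <= snd (chart beta x y) < 1.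
Proof.
  intros Hb; unfold chart; simpl; pose proof (pmod_range (1 - beta) (y - beta)); lra.
Qed.

Lemma chart_inj (beta x x' y y' : R) :
  chart beta x y = chart beta x' y' ->
  x = x' /\ exists k : Z, y' - y = (1 - beta) * IZR k.
Proof.
  unfold chart, pmod; intros H; injection H as Hx Hy; split; auto.
  exists (Int_part ((y' - beta) / (1 - beta)) - Int_part ((y - beta) / (1 - beta)))%Z.
  rewrite minus_IZR; lra.
Qed.

Definition column (a b beta x : R) : Prop :=
  (forall y, beta <= y <= 1 -> inL a b (x, y)) /\ same_pt a b (x, beta) (x, 1).

(** [p] may be another representative of [phi X Y], because a vector crossing an edge has to be
    applied on the side it points to. Only [y] is bounded by [e]: the chart is global in the
    abscissa. *)
Definition develops (a b l u : R) (phi : R -> R -> pt) : Prop :=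
  forall X Y, l <= X <= u -> exists e, 0 < e /\
    forall x y, l <= X + x <= u -> Rabs y < e ->
      exists p, inL a b p /\ same_pt a b p (phi X Y) /\
        inL a b (padd p (x, y)) /\ same_pt a b (phi (X + x) (Y + y)) (padd p (x, y)).

Lemma chart_develops (a b beta l u xi eta : R) : beta < 1 ->
  (forall x, l + xi <= x <= u + xi -> column a b beta x) ->
  develops a b l u (fun X Y => chart beta (X + xi) (Y + eta)).
Proof.
  intros Hb Hcol X Y HX.
  pose proof (pmod_range (1 - beta) (Y + eta - beta) ltac:(lra)) as Hz.
  set (z := pmod _ _) in Hz.
  set (k := Int_part ((Y + eta - beta) / (1 - beta))).
  assert (EY : Y + eta = beta + z + (1 - beta) * IZR k) by (unfold z, pmod, k; ring).
  assert (E0 : chart beta (X + xi) (Y + eta) = (X + xi, beta + z)) by reflexivity.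
  destruct (Hcol (X + xi)) as [CL CS]; [lra|].
  assert (Same : forall x y, l <= X + x <= u -> 0 <= z + y < 1 - beta ->
    exists p, inL a b p /\ same_pt a b p (chart beta (X + xi) (Y + eta)) /\
      inL a b (padd p (x, y)) /\
      same_pt a b (chart beta (X + x + xi) (Y + y + eta)) (padd p (x, y))).
  { intros x y Hx Hy; exists (X + xi, beta + z).
    rewrite (chart_eq beta (X + x + xi) _ (beta + z + y) k) by lra.
    rewrite E0; unfold padd; simpl.
    replace (X + xi + x) with (X + x + xi) by ring.
    split; [apply CL; lra|]; split; [apply same_pt_refl|].
    split; [apply Hcol; lra|apply same_pt_refl]. }
  (* On the seam [z = 0], a downward displacement starts from the upper representative, of height 1,
     and the turn count drops to [k - 1]. *)
  destruct (Req_dec z 0) as [z0|z0].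
  - exists (1 - beta); split; [lra|]; intros x y Hx Hy; apply Rabs_def2 in Hy.
    destruct (Rle_lt_dec 0 y); [apply Same; lra|].
    exists (X + xi, 1).
    rewrite (chart_eq beta (X + x + xi) _ (1 + y) (k - 1)) by (rewrite ?minus_IZR; lra).
    rewrite E0, z0, Rplus_0_r; unfold padd; simpl.
    replace (X + xi + x) with (X + x + xi) by ring.
    split; [apply CL; lra|]; split; [apply same_pt_sym; auto|].
    split; [apply Hcol; lra|apply same_pt_refl].
  - exists (Rmin z (1 - beta - z)); split; [apply Rmin_glb_lt; lra|].
    intros x y Hx Hy; apply Rmin_Rgt_l in Hy as [Hy1 Hy2].
    apply Rgt_lt, Rabs_def2 in Hy1, Hy2; apply Same; lra.
Qed.

(** The intervals are closed, so a piece missing [X] misses a neighbourhood of it; hence for small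
    [e] every piece reached from [X] already contains [X]. *)
Lemma develops_list (a b : R) (pieces : list (R * R * (R -> R -> pt))) (X Y : R) :
  (forall l u phi, In (l, u, phi) pieces -> develops a b l u phi) ->
  exists e, 0 < e /\ forall x y l u phi, Rabs x < e -> Rabs y < e ->
    In (l, u, phi) pieces -> l <= X + x <= u -> l <= X <= u /\
    exists p, inL a b p /\ same_pt a b p (phi X Y) /\
      inL a b (padd p (x, y)) /\ same_pt a b (phi (X + x) (Y + y)) (padd p (x, y)).
Proof.
  induction pieces as [|[[l u] phi] pieces IH]; intros H.
  - exists 1; split; [lra|]; intros x y l u phi _ _ [].
  - destruct IH as (e & He & IH); [intros; apply H; right; auto|].
    assert (Hd : exists e', 0 < e' /\ forall x y, Rabs x < e' -> Rabs y < e' ->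
      l <= X + x <= u -> l <= X <= u /\
      exists p, inL a b p /\ same_pt a b p (phi X Y) /\
        inL a b (padd p (x, y)) /\ same_pt a b (phi (X + x) (Y + y)) (padd p (x, y))).
    { destruct (Rlt_le_dec X l) as [Hl|Hl];
        [|destruct (Rlt_le_dec u X) as [Hu|Hu]].
      - exists (l - X); split; [lra|]; intros x y Hx; apply Rabs_def2 in Hx; lra.
      - exists (X - u); split; [lra|]; intros x y Hx; apply Rabs_def2 in Hx; lra.
      - destruct (H l u phi (or_introl eq_refl) X Y) as (e' & He' & D); [lra|].
        exists e'; split; [lra|]; auto. }
    destruct Hd as (e' & He' & Hd).
    exists (Rmin e e'); split; [apply Rmin_glb_lt; auto|].
    intros x y l' u' phi' Hx Hy Hin; apply Rmin_Rgt_l in Hx as [], Hy as [].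
    destruct Hin as [E|Hin]; [injection E as -> -> ->|]; auto.
Qed.

(** * Cylinders from strips around closed geodesics *)

(** Every gluing ends on [x = 1] or [y = 1]; without these edges, regular points have at most one
    representative. *)
Lemma same_pt_half_open (a b : R) (p q : pt) : 0 < a < 1 -> 0 < b < 1 ->
  same_pt a b p q -> 0 < sing_fun a b p ->
  fst p < 1 -> snd p < 1 -> fst q < 1 -> snd q < 1 -> p = q.
Proof.
  intros Ha Hb S Hf Hp1 Hp2 Hq1 Hq2.
  destruct (same_pt_cases a b p q) as [|[G|G]]; auto; exfalso;
    destruct G; simpl in *; lra.
Qed.

Definition periodic_ext (T : R) (D : R -> R -> pt) (X v : R) : pt :=
  D (X - IZR (Int_part (X / T)) * T) v.

Lemma periodic_ext_shift (T : R) (D : R -> R -> pt) (X v : R) (k : Z) :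
  0 < T -> periodic_ext T D (X + IZR k * T) v = periodic_ext T D X v.
Proof.
  intros HT; unfold periodic_ext.
  assert (E : (X + IZR k * T) / T = X / T + IZR k) by (field; apply Rgt_not_eq; lra).
  rewrite E, (Int_part_unique _ (Int_part (X / T) + k)).
  - rewrite plus_IZR; f_equal; ring.
  - rewrite plus_IZR; destruct (base_Int_part (X / T)); lra.
Qed.

Lemma periodic_ext_reduce (T X : R) : 0 < T -> exists k : Z, 0 <= X + IZR k * T < T.
Proof.
  intros HT; exists (- Int_part (X / T))%Z; rewrite opp_IZR.
  pose proof (pmod_range T X HT) as H; unfold pmod in H; lra.
Qed.

Lemma periodic_ext_id (T : R) (D : R -> R -> pt) (X v : R) :
  0 <= X < T -> periodic_ext T D X v = D X v.
Proof.
  intros HX; unfold periodic_ext; f_equal.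
  transitivity (pmod T X); [unfold pmod; ring|].
  apply (pmod_unique _ _ _ 0); lra.
Qed.

(** [D X v] is the point of the surface at abscissa [X] and vertical offset [v]
    from a closed geodesic of slope [sigma] and horizontal extent [T]; each
    piece is a chart of the surface in the unsheared coordinates
    [(X, sigma * X + v)]. *)
Lemma strip_cylinder (a b T sigma r eps : R) (D : R -> R -> pt)
    (pieces : list (R * R * (R -> R -> pt))) :
  0 < a < 1 -> 0 < b < 1 -> 0 < T -> 0 < r -> 0 < eps ->
  (forall l u phi, In (l, u, phi) pieces -> develops a b l u phi /\
     forall X v, l <= X <= u -> - eps < X < T -> - r < v < r ->
       same_pt a b (periodic_ext T D X v) (phi X (sigma * X + v))) ->
  (forall X, - eps < X < T -> exists l u phi, In (l, u, phi) pieces /\ l <= X <= u) ->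
  (forall X v, 0 <= X < T -> - r < v < r -> inL a b (D X v) /\
     fst (D X v) < 1 /\ snd (D X v) < 1 /\ 0 < sing_fun a b (D X v)) ->
  (forall X X' v v', 0 <= X < T -> 0 <= X' < T -> - r < v < r -> - r < v' < r ->
     D X v = D X' v' -> X = X' /\ v = v') ->
  (exists X x y, 0 <= X < T /\ inL a b (x, y) /\ sing_fun a b (x, y) = 0 /\
     forall v, - r < v < r -> D X v = (x, y + (v + r))) ->
  (exists X x y, 0 <= X < T /\ inL a b (x, y) /\ sing_fun a b (x, y) = 0 /\
     forall v, - r < v < r -> D X v = (x, y + (v - r))) ->
  forall X X', 0 <= X < T -> 0 <= X' < T -> core_joined a b (D X 0) (D X' 0).
Proof.
  intros Ha Hb HT Hr Heps Hpieces Hcover HD Hinj Hbot Htop.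
  set (N := sqrt (1 + sigma ^ 2)).
  assert (HN2 : N ^ 2 = 1 + sigma ^ 2) by (apply pow2_sqrt; nra).
  assert (HN : 0 < N) by (apply sqrt_lt_R0; nra).
  set (c := / N); assert (cN : c * N = 1) by (apply Rinv_l, Rgt_not_eq; auto).
  set (d := sigma * c); set (h := 2 * r / N); set (w := T * N).
  assert (Hc : 0 < c) by (apply Rinv_0_lt_compat; auto).
  assert (Hcd : c ^ 2 + d ^ 2 = 1).
  { transitivity (c ^ 2 * (1 + sigma ^ 2)); [unfold d; ring|].
    rewrite <- HN2, <- Rpow_mult_distr, cN; ring. }
  assert (Hdc : c + sigma * d = N).
  { transitivity (c * (1 + sigma ^ 2)); [unfold d; ring|].
    rewrite <- HN2; transitivity (c * N * N); [ring|rewrite cN; ring]. }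
  assert (Hh : N * h = 2 * r) by (unfold h; field; apply Rgt_not_eq; auto).
  assert (hpos : 0 < h) by (apply Rdiv_lt_0_compat; lra).
  assert (Hv : forall t, 0 < t < h -> - r < N * t - r < r) by (intros; nra).
  (* Rotating [(s, t)] by [(c, d)] gives abscissa [c * s - d * t] and vertical offset
     [(c + sigma * d) * t = N * t] from the line of slope [sigma]; subtracting [r] puts the geodesic
     at [t = h / 2]. *)
  set (F := fun s t => periodic_ext T D (c * s - d * t) (N * t - r)).
  assert (HX : forall X t, c * (N * X + sigma * t) - d * t = X).
  { intros X t; transitivity (c * N * X); [unfold d; ring|rewrite cN; ring]. }
  assert (HDF : forall X v, - r < v < r ->
    inL a b (periodic_ext T D X v) /\ fst (periodic_ext T D X v) < 1 /\
    snd (periodic_ext T D X v) < 1 /\ 0 < sing_fun a b (periodic_ext T D X v)).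
  { intros X v HV; destruct (periodic_ext_reduce T X HT) as [k Hk].
    rewrite <- (periodic_ext_shift T D X v k HT), periodic_ext_id by auto; auto. }
  assert (HF : is_flat_cyl a b w h c d F).
  { split; [unfold w; nra|]; split; [auto|]; split; [auto|]; split; [|split; [|split]].
    - intros s t Ht; destruct (HDF (c * s - d * t) (N * t - r)) as (L & _ & _ & P); auto.
      split; [exact L|apply pos_nonsingular; exact P].
    - intros s t Ht; unfold F.
      replace (c * (s + w) - d * t) with (c * s - d * t + IZR 1 * T).
      + rewrite periodic_ext_shift by auto; apply same_pt_refl.
      + unfold w; replace (c * (s + T * N)) with (c * s + c * N * T) by ring.
        rewrite cN; ring.
    - intros s t s' t' Ht Ht' E.
      destruct (HDF (c * s - d * t) (N * t - r)) as (L1 & A1 & B1 & P1); auto.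
      destruct (HDF (c * s' - d * t') (N * t' - r)) as (L2 & A2 & B2 & P2); auto.
      apply same_pt_half_open in E; auto; unfold F in E.
      destruct (periodic_ext_reduce T (c * s - d * t) HT) as [k Hk].
      destruct (periodic_ext_reduce T (c * s' - d * t') HT) as [k' Hk'].
      rewrite <- (periodic_ext_shift T D _ _ k HT), periodic_ext_id in E by auto.
      rewrite <- (periodic_ext_shift T D (c * s' - _) _ k' HT), periodic_ext_id in E by auto.
      apply Hinj in E as [EX Ev]; auto.
      assert (Et : t = t') by (apply Rmult_eq_reg_l with N; [lra|apply Rgt_not_eq; auto]).
      subst t'; split; auto.
      exists (k - k')%Z; rewrite minus_IZR; unfold w.
      apply Rmult_eq_reg_l with c; [|apply Rgt_not_eq; auto].
      replace (c * (s + (IZR k - IZR k') * (T * N)))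
        with (c * s + (IZR k - IZR k') * T * (c * N)) by ring.
      rewrite cN; lra.
    - intros s t Ht.
      destruct (periodic_ext_reduce T (c * s - d * t) HT) as [k Hk].
      set (X0 := c * s - d * t + IZR k * T) in *; set (v := N * t - r).
      destruct (develops_list a b pieces X0 (sigma * X0 + v)) as (e & He & Hdev);
        [intros; apply Hpieces; auto|].
      (* As [0 <= X0 < T], such displacements stay in [(- eps, T)]. The margin left of 0 makes every
         reduced abscissa interior to the covered range. *)
      set (m := Rmin e (Rmin eps (T - X0))).
      assert (Hm : 0 < m) by (repeat apply Rmin_glb_lt; lra).
      assert (m <= e) by apply Rmin_l.
      assert (m <= Rmin eps (T - X0)) by apply Rmin_r.
      pose proof (Rmin_l eps (T - X0)); pose proof (Rmin_r eps (T - X0)).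
      exists m; split; auto; intros ds dt Hds Hdt.
      set (x := c * ds - d * dt); set (y := d * ds + c * dt).
      destruct (abs_lt_of_sq_sum x y m) as [Hx Hy]; auto.
      { replace (x ^ 2 + y ^ 2) with ((c ^ 2 + d ^ 2) * (ds ^ 2 + dt ^ 2))
          by (unfold x, y; ring).
        rewrite Hcd; lra. }
      assert (HXx : - eps < X0 + x < T) by (apply Rabs_def2 in Hx; lra).
      destruct (Hcover _ HXx) as (l & u & phi & Hin & Hlu).
      destruct (Hdev x y l u phi) as (Hlu0 & p & Lp & Ep & Lpv & Epv); auto; try lra.
      destruct (Hpieces l u phi Hin) as [_ Hphi].
      exists p; unfold rot, F; simpl fst; simpl snd; fold x y v.
      split; [auto|]; split; [|split; [auto|]].
      + eapply same_pt_trans; [exact Ep|]; apply same_pt_sym.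
        rewrite <- (periodic_ext_shift T D _ v k HT); fold X0.
        apply Hphi; auto; [lra|apply Hv; auto].
      + eapply same_pt_trans; [|exact Epv].
        rewrite <- (periodic_ext_shift T D _ _ k HT).
        replace (c * (s + ds) - d * (t + dt) + IZR k * T) with (X0 + x)
          by (unfold X0, x; ring).
        replace (sigma * X0 + v + y) with (sigma * (X0 + x) + (N * (t + dt) - r)).
        * apply Hphi; auto.
        * unfold v; rewrite <- Hdc; unfold x, y, d; ring. }
  (* The point moves vertically into the singularity: [te = 0] and [sg = 1] for the lower boundary,
     [te = h] and [sg = -1] for the upper one. *)
  assert (Hacc : forall X x y te sg, 0 <= X < T -> inL a b (x, y) ->
    sing_fun a b (x, y) = 0 -> Rabs sg = 1 ->
    (forall z, 0 < z < h -> 0 < te + sg * z < h) ->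
    (forall z, 0 < z < h -> D X (N * (te + sg * z) - r) = (x, y + sg * (N * z))) ->
    clusters_at_sing a b h F te).
  { intros X x y te sg HXT Lxy Sxy Hsg Hte HDX.
    exists (N * X + sigma * te); intros e He.
    destruct (Rmult_small sigma e He) as (e1 & He1 & Hm1).
    destruct (Rmult_small (6 * N) e He) as (e2 & He2 & Hm2).
    set (z := Rmin (Rmin e1 e2) (Rmin e h) / 2).
    pose proof (Rmin_l (Rmin e1 e2) (Rmin e h)); pose proof (Rmin_r (Rmin e1 e2) (Rmin e h)).
    pose proof (Rmin_l e1 e2); pose proof (Rmin_r e1 e2).
    pose proof (Rmin_l e h); pose proof (Rmin_r e h).
    assert (0 < Rmin (Rmin e1 e2) (Rmin e h)) by (repeat apply Rmin_glb_lt; auto).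
    assert (Hz : 0 < z /\ z < e1 /\ z < e2 /\ z < e /\ z < h) by (unfold z; lra).
    clearbody z; destruct Hz as (Hz0 & Hz1 & Hz2 & Hz3 & Hz4).
    exists (N * X + sigma * (te + sg * z)), (te + sg * z).
    split; [|split; [|split]].
    - replace (_ - _) with (sg * (z * sigma)) by ring.
      rewrite Rabs_mult, Hsg, Rmult_1_l; apply Hm1; rewrite Rabs_pos_eq; lra.
    - replace (_ - _) with (sg * z) by ring.
      rewrite Rabs_mult, Hsg, Rmult_1_l, Rabs_pos_eq; lra.
    - apply Hte; lra.
    - assert (Hzt : 0 < te + sg * z < h) by (apply Hte; lra).
      destruct (HD X (N * (te + sg * z) - r)) as (L & _ & _ & P); auto.
      unfold F; rewrite HX, periodic_ext_id by auto.
      rewrite HDX in * by lra.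
      pose proof (sing_fun_lipschitz a b _ _ Ha Hb L Lxy) as Hlip.
      rewrite Sxy, Rminus_0_r, Rabs_pos_eq in Hlip by lra; cbn [fst snd] in Hlip.
      replace (x - x) with 0 in Hlip by ring; rewrite Rabs_R0, Rplus_0_l in Hlip.
      replace (y + sg * (N * z) - y) with (sg * (N * z)) in Hlip by ring.
      rewrite Rabs_mult, Hsg, Rmult_1_l, Rabs_pos_eq in Hlip by nra.
      specialize (Hm2 z); rewrite !Rabs_pos_eq in Hm2 by nra; lra. }
  assert (HC : cylinder a b w h c d F).
  { apply cylinder_of_sing_clusters; auto.
    - destruct Hbot as (X & x & y & HXT & Lxy & Sxy & E).
      apply (Hacc X x y 0 1); auto; [apply Rabs_R1|intros; lra|].
      intros z Hz; rewrite E; [f_equal; ring|].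
      replace (0 + 1 * z) with z by ring; auto.
    - destruct Htop as (X & x & y & HXT & Lxy & Sxy & E).
      apply (Hacc X x y h (-1)); auto; [rewrite Rabs_left; lra|intros; lra|].
      intros z Hz; rewrite E; [f_equal; lra|]; apply Hv; lra. }
  assert (Hcore : forall X, 0 <= X < T -> core_through a b h F (D X 0)).
  { intros X HXT; exists (N * X + sigma * (h / 2)); unfold F.
    rewrite HX; replace (N * (h / 2) - r) with 0 by lra.
    rewrite periodic_ext_id by auto; apply same_pt_refl. }
  intros X X' HXT HXT'; exists w, h, c, d, F; auto.
Qed.

(** * The explicit closed geodesics *)

Lemma right_column (a b x : R) : 0 < a < 1 -> 0 < b < 1 -> a <= x <= 1 -> column a b 0 x.
Proof.
  intros Ha Hb Hx; split; [unfold inL; simpl; intros; lra|].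
  apply glue_same_pt, glue_bot_top; auto.
Qed.

Lemma left_column (a b x : R) : 0 < a < 1 -> 0 < b < 1 -> 0 <= x <= a -> column a b b x.
Proof.
  intros Ha Hb Hx; split; [unfold inL; simpl; intros; lra|].
  apply glue_same_pt, glue_hole_horiz; auto.
Qed.

Lemma chart_inL (a b beta x y : R) :
  beta < 1 -> column a b beta x -> inL a b (chart beta x y).
Proof.
  intros Hb [C _]; pose proof (chart_range beta x y Hb).
  rewrite (surjective_pairing (chart beta x y)).
  replace (fst _) with x by tauto; apply C; lra.
Qed.

Lemma int_multiple_small (m : R) (k : Z) : - m < m * IZR k < m -> k = 0%Z.
Proof. intros H; apply one_IZR_lt1; nra. Qed.

Lemma step_into_interval (x s L : R) : 0 < s < L -> exists j : Z, 0 < x + s * IZR j < L.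
Proof.
  intros Hs; pose proof (pmod_range s x ltac:(lra)) as H; unfold pmod in H.
  set (k := Int_part (x / s)) in *.
  (* The target is open at 0, so a remainder equal to 0 needs one more step. *)
  destruct (Req_dec (x - s * IZR k) 0).
  - exists (1 - k)%Z; rewrite minus_IZR; lra.
  - exists (- k)%Z; rewrite opp_IZR; lra.
Qed.

(** The geodesic crosses the cylinders over [0, a] and [a, 1] once each, and
    passes [x = 0] and [x = a] at heights symmetric about [(1 + b) / 2]. *)
Lemma core_joined_two_crossings (a b : R) (k m : Z) : 0 < a < 1 -> 0 < b < 1 ->
  - (1 - b) < IZR m * (1 - a) * (1 - b) - IZR k * a < 1 - b ->
  core_joined a b (chart b (a / 2) ((1 + b) / 2 + IZR m * (1 - b) / 2))
    (chart 0 ((1 + a) / 2) ((1 + b + IZR k) / 2)).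
Proof.
  intros Ha Hb; set (e := IZR m * (1 - a) * (1 - b) - IZR k * a); intros He.
  (* The horizontal extent is 1, so the slope is the total rise: [k] turns of length 1 and [m] turns
     of length [1 - b]. Here [y0] is the height at [x = a] and [y1] the height at [x = 0]. With
     [y0 + y1 = 1 + b], closing up forces [y1 - y0 = e], and the bound on [e] places both heights in
     [(b, 1)]. *)
  set (sigma := IZR k + IZR m * (1 - b)).
  set (y0 := (1 + b - e) / 2); set (y1 := (1 + b + e) / 2).
  assert (Sa : sigma * a = y0 - y1 + IZR m * (1 - b)) by (unfold sigma, y0, y1, e; field).
  assert (Sb : sigma * (1 - a) = y1 - y0 + IZR k) by (unfold sigma, y0, y1, e; field).
  (* By symmetry [y0 - b = 1 - y1], so the same [r] is the distance to the singularity above and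
     below the geodesic. *)
  set (r := Rmin (y0 - b) (y1 - b)).
  assert (Hr : 0 < r) by (unfold r, y0, y1; apply Rmin_glb_lt; lra).
  assert (R0 : r <= y0 - b) by apply Rmin_l; assert (R1 : r <= y1 - b) by apply Rmin_r.
  assert (Hy : y0 + y1 = 1 + b) by (unfold y0, y1; field).
  set (D := fun X v => if Rlt_dec X a then chart b X (sigma * X + v + y1)
                       else chart 0 X (sigma * X + v + (y0 - sigma * a))).
  assert (DL : forall X v, X < a -> D X v = chart b X (sigma * X + v + y1))
    by (intros; unfold D; destruct (Rlt_dec X a); [auto|lra]).
  assert (DR : forall X v, a <= X -> D X v = chart 0 X (sigma * X + v + (y0 - sigma * a)))
    by (intros; unfold D; destruct (Rlt_dec X a); [lra|auto]).
  assert (D0 : forall v, - r < v < r -> D 0 v = (0, y1 + v))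
    by (intros; rewrite DL by lra; apply (chart_eq _ _ _ _ 0); lra).
  assert (Da : forall v, - r < v < r -> D a v = (a, y0 + v))
    by (intros; rewrite DR by lra; apply (chart_eq _ _ _ _ 0); lra).
  assert (E1 : chart b (a / 2) ((1 + b) / 2 + IZR m * (1 - b) / 2) = D (a / 2) 0)
    by (rewrite DL by lra; f_equal; lra).
  assert (E2 : chart 0 ((1 + a) / 2) ((1 + b + IZR k) / 2) = D ((1 + a) / 2) 0)
    by (rewrite DR by lra; f_equal; lra).
  rewrite E1, E2.
  (* The first piece is the crossing of [[a, 1]] from the previous period, shifted by 1; it supplies
     the margin left of [X = 0]. *)
  apply strip_cylinder with (T := 1) (sigma := sigma) (r := r) (eps := 1 - a)
    (pieces := ((a - 1, 0, fun X Y => chart 0 (X + 1) (Y + (sigma - sigma * a + y0)))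
      :: (0, a, fun X Y => chart b (X + 0) (Y + y1))
      :: (a, 1, fun X Y => chart 0 (X + 0) (Y + (y0 - sigma * a))) :: nil)%list);
    auto; try lra.
  - intros l u phi [E|[E|[E|[]]]]; injection E as <- <- <-; split;
      try (apply chart_develops; [lra|intros; first
        [apply right_column; auto; lra | apply left_column; auto; lra]]);
      intros X v HX HXT HV.
    + destruct (Req_dec X 0) as [->|HX0].
      * rewrite periodic_ext_id, D0 by (auto; lra).
        rewrite (chart_eq _ _ _ (y1 + v) k) by lra; rewrite Rplus_0_l.
        apply glue_same_pt, glue_left_right; lra.
      * rewrite <- (periodic_ext_shift _ _ _ _ 1), periodic_ext_id, DR by lra.
        rewrite Rmult_1_l; replace (sigma * (X + 1) + v + (y0 - sigma * a))
          with (sigma * X + v + (sigma - sigma * a + y0)) by ring.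
        apply same_pt_refl.
    + rewrite periodic_ext_id by lra; destruct (Req_dec X a) as [->|HXa].
      * rewrite Da, (chart_eq _ _ _ (y0 + v) m) by lra; rewrite Rplus_0_r.
        apply same_pt_refl.
      * rewrite DL, Rplus_0_r by lra; apply same_pt_refl.
    + rewrite periodic_ext_id, DR, Rplus_0_r by lra; apply same_pt_refl.
  - intros X HX; destruct (Rle_lt_dec X 0); [|destruct (Rle_lt_dec X a)].
    + do 3 eexists; split; [left; reflexivity|lra].
    + do 3 eexists; split; [right; left; reflexivity|lra].
    + do 3 eexists; split; [right; right; left; reflexivity|lra].
  - intros X v HX HV; destruct (Rlt_le_dec X a) as [HXa|HXa].
    + rewrite DL by auto.
      destruct (chart_range b X (sigma * X + v + y1)) as [F S]; [lra|].
      split; [apply chart_inL; [lra|apply left_column; auto; lra]|].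
      split; [lra|]; split; [lra|]; rewrite <- DL by auto.
      destruct (Req_dec X 0) as [->|].
      * rewrite D0 by auto; apply sing_fun_pos_snd; simpl; lra.
      * rewrite DL by auto; apply sing_fun_pos_fst; rewrite F; lra.
    + rewrite DR by auto.
      destruct (chart_range 0 X (sigma * X + v + (y0 - sigma * a))) as [F S]; [lra|].
      split; [apply chart_inL; [lra|apply right_column; auto; lra]|].
      split; [lra|]; split; [lra|]; rewrite <- DR by auto.
      destruct (Req_dec X a) as [->|].
      * rewrite Da by auto; apply sing_fun_pos_snd; simpl; lra.
      * rewrite DR by auto; apply sing_fun_pos_fst; rewrite F; lra.
  - intros X X' v v' HX HX' HV HV' E.
    assert (EX : X = X').
    { transitivity (fst (D X v)); [|rewrite E]; unfold D; destruct (Rlt_dec _ a); reflexivity. }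
    subst X'; split; auto; destruct (Rlt_le_dec X a) as [HXa|HXa].
    + rewrite !DL in E by auto; apply chart_inj in E as [_ [j Hj]].
      assert (j = 0%Z) by (apply (int_multiple_small (1 - b)); lra).
      subst j; lra.
    + rewrite !DR in E by auto; apply chart_inj in E as [_ [j Hj]].
      assert (j = 0%Z) by (apply (int_multiple_small 1); lra).
      subst j; lra.
  - destruct (Rle_lt_dec y0 y1).
    + assert (Er : r = y0 - b) by (apply Rmin_left; lra).
      exists a, a, b; split; [lra|]; split; [unfold inL; simpl; lra|].
      split; [unfold sing_fun, cubic; simpl; ring|].
      intros v HV; rewrite Da by auto; f_equal; lra.
    + assert (Er : r = y1 - b) by (apply Rmin_right; lra).
      exists 0, 0, b; split; [lra|]; split; [unfold inL; simpl; lra|].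
      split; [unfold sing_fun, cubic; simpl; ring|].
      intros v HV; rewrite D0 by auto; f_equal; lra.
  - destruct (Rle_lt_dec y0 y1).
    + assert (Er : r = y0 - b) by (apply Rmin_left; lra).
      exists 0, 0, 1; split; [lra|]; split; [unfold inL; simpl; lra|].
      split; [unfold sing_fun, cubic; simpl; ring|].
      intros v HV; rewrite D0 by auto; f_equal; lra.
    + assert (Er : r = y1 - b) by (apply Rmin_right; lra).
      exists a, a, 1; split; [lra|]; split; [unfold inL; simpl; lra|].
      split; [unfold sing_fun, cubic; simpl; ring|].
      intros v HV; rewrite Da by auto; f_equal; lra.
Qed.

(** The geodesic crosses the cylinder over [0, a] once and the cylinder over
    [a, 1] twice; between these two crossings it meets the vertical side of
    the hole at its midpoint. *)
Lemma core_joined_three_crossings (a b sigma : R) (m : Z) : 0 < a < 1 -> 0 < b < 1 ->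
  sigma * (2 - a) = 1 + IZR m * (1 - b) ->
  b < b / 2 + sigma * (1 - a) < 1 ->
  core_joined a b (a, b / 2) (chart b (a / 2) ((1 + b) / 2 + IZR m * (1 - b) / 2)).
Proof.
  (* The involution exchanges the two crossings of [[a, 1]], which dictates [y0]. The crossing from
     [(a, y0)] arrives at height [1 + b / 2], one turn above the midpoint of the hole's side; the
     next one starts at that midpoint and arrives at [y1]. *)
  intros Ha Hb HS; set (y1 := b / 2 + _); intros Hy1; set (y0 := 1 + b - y1).
  assert (Sb : sigma - sigma * a = y1 - b / 2) by (unfold y1; ring).
  assert (Sa : sigma * a = y0 - y1 + IZR m * (1 - b)) by (unfold y0; lra).
  assert (Hy0 : y0 + y1 = 1 + b) by (unfold y0; ring).
  clearbody y0 y1.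
  (* The strip must also clear the two ends of the hole's side, at distance [b / 2] from its
     midpoint. *)
  set (r := Rmin (Rmin (y0 - b) (y1 - b)) (b / 2)).
  assert (Hr : 0 < r) by (unfold r; repeat apply Rmin_glb_lt; lra).
  assert (R2 : r <= b / 2) by apply Rmin_r.
  assert (R01 : r <= Rmin (y0 - b) (y1 - b)) by apply Rmin_l.
  pose proof (Rmin_l (y0 - b) (y1 - b)) as R0; pose proof (Rmin_r (y0 - b) (y1 - b)) as R1.
  set (D := fun X v => if Rlt_dec X a then chart b X (sigma * X + v + y1)
     else if Rlt_dec X 1 then chart 0 X (sigma * X + v + (y0 - sigma * a))
     else chart 0 (X + (a - 1)) (sigma * X + v + (b / 2 - sigma))).
  assert (DL : forall X v, X < a -> D X v = chart b X (sigma * X + v + y1))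
    by (intros; unfold D; destruct (Rlt_dec X a); [auto|lra]).
  assert (DR : forall X v, a <= X < 1 ->
    D X v = chart 0 X (sigma * X + v + (y0 - sigma * a)))
    by (intros; unfold D; destruct (Rlt_dec X a), (Rlt_dec X 1); auto; lra).
  assert (DR' : forall X v, 1 <= X ->
    D X v = chart 0 (X + (a - 1)) (sigma * X + v + (b / 2 - sigma)))
    by (intros; unfold D; destruct (Rlt_dec X a), (Rlt_dec X 1); auto; lra).
  assert (D0 : forall v, - r < v < r -> D 0 v = (0, y1 + v))
    by (intros; rewrite DL by lra; apply (chart_eq _ _ _ _ 0); lra).
  assert (Da : forall v, - r < v < r -> D a v = (a, y0 + v))
    by (intros; rewrite DR by lra; apply (chart_eq _ _ _ _ 0); lra).
  assert (D1 : forall v, - r < v < r -> D 1 v = (a, b / 2 + v)).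
  { intros; rewrite DR' by lra; replace (1 + (a - 1)) with a by ring.
    apply (chart_eq _ _ _ _ 0); lra. }
  assert (E1 : (a, b / 2) = D 1 0) by (rewrite D1 by lra; f_equal; ring).
  assert (E2 : chart b (a / 2) ((1 + b) / 2 + IZR m * (1 - b) / 2) = D (a / 2) 0)
    by (rewrite DL by lra; f_equal; lra).
  rewrite E1, E2.
  apply strip_cylinder with (T := 2 - a) (sigma := sigma) (r := r) (eps := 1 - a)
    (pieces := ((a - 1, 0, fun X Y => chart 0 (X + 1) (Y + y1))
      :: (0, a, fun X Y => chart b (X + 0) (Y + y1))
      :: (a, 1, fun X Y => chart 0 (X + 0) (Y + (y0 - sigma * a)))
      :: (1, 2 - a, fun X Y => chart 0 (X + (a - 1)) (Y + (b / 2 - sigma))) :: nil)%list);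
    auto; try lra.
  - intros l u phi [E|[E|[E|[E|[]]]]]; injection E as <- <- <-; split;
      try (apply chart_develops; [lra|intros; first
        [apply right_column; auto; lra | apply left_column; auto; lra]]);
      intros X v HX HXT HV.
    + destruct (Req_dec X 0) as [->|HX0].
      * rewrite periodic_ext_id, D0 by (auto; lra).
        rewrite (chart_eq _ _ _ (y1 + v) 0) by lra; rewrite Rplus_0_l.
        apply glue_same_pt, glue_left_right; lra.
      * rewrite <- (periodic_ext_shift _ _ _ _ 1), periodic_ext_id, DR' by lra.
        rewrite Rmult_1_l; replace (X + (2 - a) + (a - 1)) with (X + 1) by ring.
        replace (sigma * (X + (2 - a)) + v + (b / 2 - sigma)) with (sigma * X + v + y1)
          by lra; apply same_pt_refl.
    + rewrite periodic_ext_id by lra; destruct (Req_dec X a) as [->|HXa].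
      * rewrite Da, (chart_eq _ _ _ (y0 + v) m) by lra; rewrite Rplus_0_r.
        apply same_pt_refl.
      * rewrite DL, Rplus_0_r by lra; apply same_pt_refl.
    + rewrite periodic_ext_id by lra; destruct (Req_dec X 1) as [->|HX1].
      * rewrite D1, (chart_eq _ _ _ (b / 2 + v) 1) by lra; rewrite Rplus_0_r.
        apply glue_same_pt, glue_hole_vert; lra.
      * rewrite DR, Rplus_0_r by lra; apply same_pt_refl.
    + rewrite periodic_ext_id, DR' by lra; apply same_pt_refl.
  - intros X HX; destruct (Rle_lt_dec X 0); [|destruct (Rle_lt_dec X a);
      [|destruct (Rle_lt_dec X 1)]].
    + do 3 eexists; split; [left; reflexivity|lra].
    + do 3 eexists; split; [right; left; reflexivity|lra].
    + do 3 eexists; split; [right; right; left; reflexivity|lra].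
    + do 3 eexists; split; [right; right; right; left; reflexivity|lra].
  - intros X v HX HV; destruct (Rlt_le_dec X a) as [HXa|HXa];
      [|destruct (Rlt_le_dec X 1) as [HX1|HX1]].
    + rewrite DL by auto.
      destruct (chart_range b X (sigma * X + v + y1)) as [F S]; [lra|].
      split; [apply chart_inL; [lra|apply left_column; auto; lra]|].
      split; [lra|]; split; [lra|]; rewrite <- DL by auto.
      destruct (Req_dec X 0) as [->|].
      * rewrite D0 by auto; apply sing_fun_pos_snd; simpl; lra.
      * rewrite DL by auto; apply sing_fun_pos_fst; rewrite F; lra.
    + rewrite DR by auto.
      destruct (chart_range 0 X (sigma * X + v + (y0 - sigma * a))) as [F S]; [lra|].
      split; [apply chart_inL; [lra|apply right_column; auto; lra]|].
      split; [lra|]; split; [lra|]; rewrite <- DR by auto.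
      destruct (Req_dec X a) as [->|].
      * rewrite Da by auto; apply sing_fun_pos_snd; simpl; lra.
      * rewrite DR by auto; apply sing_fun_pos_fst; rewrite F; lra.
    + rewrite DR' by auto.
      destruct (chart_range 0 (X + (a - 1)) (sigma * X + v + (b / 2 - sigma))) as [F S];
        [lra|].
      split; [apply chart_inL; [lra|apply right_column; auto; lra]|].
      split; [lra|]; split; [lra|]; rewrite <- DR' by auto.
      destruct (Req_dec X 1) as [->|].
      * rewrite D1 by auto; apply sing_fun_pos_snd; simpl; lra.
      * rewrite DR' by auto; apply sing_fun_pos_fst; rewrite F; lra.
  (* At [x = a] the two crossings of [[a, 1]] occupy heights in [(b, 1)] and in [(0, b)]; having the
     same slope, they remain disjoint modulo 1. *)
  - assert (Key : forall X X' v v', a <= X < 1 -> 1 <= X' < 2 - a ->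
      - r < v < r -> - r < v' < r -> D X v <> D X' v').
    { intros X X' v v' HX HX' HV HV' E.
      rewrite DR, DR' in E by lra; apply chart_inj in E as [EX [j Hj]].
      replace X with (X' + (a - 1)) in Hj by lra.
      assert (j = 0%Z) by (apply (int_multiple_small 1); lra).
      subst j; lra. }
    assert (DF : forall X v, fst (D X v) = if Rlt_dec X 1 then X else X + (a - 1)).
    { intros X v; unfold D; destruct (Rlt_dec X a), (Rlt_dec X 1); auto; lra. }
    intros X X' v v' HX HX' HV HV' E.
    pose proof (f_equal fst E) as EX; rewrite !DF in EX.
    destruct (Rlt_dec X 1) as [HX1|HX1], (Rlt_dec X' 1) as [HX1'|HX1'].
    + subst X'; split; auto; destruct (Rlt_le_dec X a) as [HXa|HXa].
      * rewrite !DL in E by auto; apply chart_inj in E as [_ [j Hj]].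
        assert (j = 0%Z) by (apply (int_multiple_small (1 - b)); lra).
        subst j; lra.
      * rewrite !DR in E by auto; apply chart_inj in E as [_ [j Hj]].
        assert (j = 0%Z) by (apply (int_multiple_small 1); lra).
        subst j; lra.
    + exfalso; apply (Key X X' v v'); auto; lra.
    + exfalso; apply (Key X' X v' v); auto; lra.
    + assert (X = X') by lra; subst X'; split; auto.
      rewrite !DR' in E by lra; apply chart_inj in E as [_ [j Hj]].
      assert (j = 0%Z) by (apply (int_multiple_small 1); lra).
      subst j; lra.
  - destruct (Rle_lt_dec (b / 2) (Rmin (y0 - b) (y1 - b))) as [H|H];
      [|destruct (Rle_lt_dec y0 y1)].
    + assert (Er : r = b / 2) by (apply Rmin_right; lra).
      exists 1, a, 0; split; [lra|]; split; [unfold inL; simpl; lra|].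
      split; [unfold sing_fun, cubic; simpl; ring|].
      intros v HV; rewrite D1 by auto; f_equal; lra.
    + assert (Er : r = y0 - b)
        by (transitivity (Rmin (y0 - b) (y1 - b)); apply Rmin_left; lra).
      exists a, a, b; split; [lra|]; split; [unfold inL; simpl; lra|].
      split; [unfold sing_fun, cubic; simpl; ring|].
      intros v HV; rewrite Da by auto; f_equal; lra.
    + assert (Er : r = y1 - b)
        by (transitivity (Rmin (y0 - b) (y1 - b)); [apply Rmin_left|apply Rmin_right]; lra).
      exists 0, 0, b; split; [lra|]; split; [unfold inL; simpl; lra|].
      split; [unfold sing_fun, cubic; simpl; ring|].
      intros v HV; rewrite D0 by auto; f_equal; lra.
  - destruct (Rle_lt_dec (b / 2) (Rmin (y0 - b) (y1 - b))) as [H|H];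
      [|destruct (Rle_lt_dec y0 y1)].
    + assert (Er : r = b / 2) by (apply Rmin_right; lra).
      exists 1, a, b; split; [lra|]; split; [unfold inL; simpl; lra|].
      split; [unfold sing_fun, cubic; simpl; ring|].
      intros v HV; rewrite D1 by auto; f_equal; lra.
    + assert (Er : r = y0 - b)
        by (transitivity (Rmin (y0 - b) (y1 - b)); apply Rmin_left; lra).
      exists 0, 0, 1; split; [lra|]; split; [unfold inL; simpl; lra|].
      split; [unfold sing_fun, cubic; simpl; ring|].
      intros v HV; rewrite D0 by auto; f_equal; lra.
    + assert (Er : r = y1 - b)
        by (transitivity (Rmin (y0 - b) (y1 - b)); [apply Rmin_left|apply Rmin_right]; lra).
      exists a, a, 1; split; [lra|]; split; [unfold inL; simpl; lra|].
      split; [unfold sing_fun, cubic; simpl; ring|].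
      intros v HV; rewrite Da by auto; f_equal; lra.
Qed.

(** The part of the surface at heights between 0 and [b] is a horizontal cylinder over [[a, 1]],
    with the singularity on both boundaries and both points at mid-height. *)
Lemma core_joined_horizontal (a b : R) : 0 < a < 1 -> 0 < b < 1 ->
  core_joined a b (a, b / 2) ((1 + a) / 2, b / 2).
Proof.
  intros Ha Hb.
  set (D := fun X v => (X + a, b / 2 + v) : pt).
  assert (E1 : (a, b / 2) = D 0 0) by (unfold D; f_equal; lra).
  assert (E2 : ((1 + a) / 2, b / 2) = D ((1 - a) / 2) 0) by (unfold D; f_equal; lra).
  assert (DE : forall X v, - (b / 2) < v < b / 2 ->
    chart 0 (X + a) (0 * X + v + b / 2) = D X v)
    by (intros; apply (chart_eq _ _ _ _ 0); lra).
  rewrite E1, E2.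
  apply strip_cylinder with (T := 1 - a) (sigma := 0) (r := b / 2) (eps := 1 - a)
    (pieces := ((a - 1, 0, fun X Y => chart 0 (X + 1) (Y + b / 2))
      :: (0, 1 - a, fun X Y => chart 0 (X + a) (Y + b / 2)) :: nil)%list);
    auto; try lra.
  - intros l u phi [E|[E|[]]]; injection E as <- <- <-; split;
      try (apply chart_develops; [lra|intros; apply right_column; auto; lra]);
      intros X v HX HXT HV.
    + rewrite (chart_eq _ _ _ (b / 2 + v) 0) by lra.
      destruct (Req_dec X 0) as [->|HX0].
      * rewrite periodic_ext_id by lra; unfold D; rewrite !Rplus_0_l.
        apply glue_same_pt, glue_hole_vert; lra.
      * rewrite <- (periodic_ext_shift _ _ _ _ 1), periodic_ext_id by lra.
        unfold D; replace (X + 1 * (1 - a) + a) with (X + 1) by ring; apply same_pt_refl.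
    + rewrite periodic_ext_id, DE by lra; apply same_pt_refl.
  - intros X HX; destruct (Rle_lt_dec X 0).
    + do 3 eexists; split; [left; reflexivity|lra].
    + do 3 eexists; split; [right; left; reflexivity|lra].
  - intros X v HX HV; unfold D; split; [unfold inL; simpl; lra|].
    simpl; split; [lra|]; split; [lra|].
    apply sing_fun_pos_snd; simpl; lra.
  - unfold D; intros X X' v v' _ _ _ _ E; injection E as; lra.
  - exists 0, a, 0; split; [lra|]; split; [unfold inL; simpl; lra|].
    split; [unfold sing_fun, cubic; simpl; ring|].
    intros v HV; unfold D; f_equal; lra.
  - exists 0, a, b; split; [lra|]; split; [unfold inL; simpl; lra|].
    split; [unfold sing_fun, cubic; simpl; ring|].
    intros v HV; unfold D; f_equal; lra.
Qed.

(** * Choice of the winding numbers *)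

(** Two turns move the midpoint of the crossing by a full circumference [1 - b], so only parity
    matters. *)
Lemma chart_left_center (a b : R) (p j : Z) : 0 < a < 1 -> 0 < b < 1 ->
  chart b (a / 2) ((1 + b) / 2 + IZR (2 * j + p) * (1 - b) / 2) =
  chart b (a / 2) ((1 + b) / 2 + IZR p * (1 - b) / 2).
Proof.
  intros Ha Hb; pose proof (chart_range b (a / 2) ((1 + b) / 2 + IZR p * (1 - b) / 2)).
  set (c := chart _ _ _) in *.
  rewrite (surjective_pairing c); replace (fst c) with (a / 2) by (symmetry; apply H; lra).
  unfold c, chart, pmod in *; simpl snd in *.
  set (k := Int_part _) in *.
  apply (chart_eq _ _ _ _ (j + k)); [lra|].
  rewrite plus_IZR, plus_IZR, mult_IZR; field.
Qed.

Lemma core_joined_left_right (a b : R) (k p : Z) : 0 < a < 1 -> 0 < b < 1 ->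
  core_joined a b (chart b (a / 2) ((1 + b) / 2 + IZR p * (1 - b) / 2))
    (chart 0 ((1 + a) / 2) ((1 + b + IZR k) / 2)).
Proof.
  intros Ha Hb.
  (* The condition on [e] is shifted by [1 - b] so that the target interval starts at 0; two more
     turns change [e] by the given step. *)
  destruct (step_into_interval (IZR p * (1 - a) * (1 - b) - IZR k * a + (1 - b))
    (2 * (1 - a) * (1 - b)) (2 * (1 - b))) as [j Hj]; [nra|].
  rewrite <- (chart_left_center a b p j) by auto.
  apply core_joined_two_crossings; auto.
  rewrite plus_IZR, mult_IZR; lra.
Qed.

Lemma core_joined_sides (a b : R) : 0 < a < 1 -> 0 < b < 1 ->
  core_joined a b (a, b / 2) (chart b (a / 2) ((1 + b) / 2 + 1 * (1 - b) / 2)).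
Proof.
  (* [q] is the share of the total rise gained on one crossing of [[a, 1]]; it is below one half
     because the crossing of [[0, a]] has positive width. An odd winding number [2 * j + 1] selects
     the point on the horizontal side of the hole. *)
  intros Ha Hb; set (q := (1 - a) / (2 - a)).
  assert (Hq : q * (2 - a) = 1 - a) by (unfold q; field; apply Rgt_not_eq; lra).
  assert (Hq' : 0 < 2 * q < 1) by nra.
  destruct (step_into_interval (q * (2 - b) - b / 2) (2 * q * (1 - b)) (1 - b))
    as [j Hj]; [nra|].
  rewrite <- (chart_left_center a b 1 j) by auto.
  apply core_joined_three_crossings
    with (sigma := (1 + IZR (2 * j + 1) * (1 - b)) / (2 - a)); auto.
  - field; apply Rgt_not_eq; lra.
  - replace ((1 + IZR (2 * j + 1) * (1 - b)) / (2 - a) * (1 - a))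
      with (q * (1 + IZR (2 * j + 1) * (1 - b))) by (unfold q; field; apply Rgt_not_eq; lra).
    rewrite plus_IZR, mult_IZR; lra.
Qed.

(** * The five Weierstrass points and their ten pairs *)

(** At a regular point, being fixed means [q = p] or one gluing. Equality gives the half-period
    points except the centre of the hole; gluing along the hole gives the midpoints of its sides;
    the torus edges would make [a] or [b] an integer. *)
Lemma regular_weierstrass_cases (a b : R) (p : pt) : 0 < a < 1 -> 0 < b < 1 ->
  regular_weierstrass a b p ->
  same_pt a b ((1 + a) / 2, b / 2) p \/ same_pt a b (a, b / 2) p \/
  same_pt a b (a / 2, (1 + b) / 2) p \/ same_pt a b ((1 + a) / 2, (1 + b) / 2) p \/
  same_pt a b (a / 2, b) p.
Proof.
  intros Ha Hb (Lp & Np & q & Lq & (m & n & E1 & E2) & S).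
  pose proof (nonsingular_pos _ _ _ Ha Hb Lp Np) as Hf.
  pose proof Lp as (P1 & P2 & P3).
  assert (I : forall k : Z, -1 < IZR k < 2 -> IZR k = 0 \/ IZR k = 1).
  { intros k [H1 H2]; apply lt_IZR in H1, H2.
    assert (k = 0 \/ k = 1)%Z as [-> | ->] by lia; auto. }
  assert (J : forall k : Z, ~ -1 < IZR k < 0).
  { intros k [H1 H2]; apply lt_IZR in H1, H2; lia. }
  apply same_pt_sym in S.
  destruct (same_pt_cases a b p q Ha Hb S Hf) as [E|[G|G]].
  - subst q; destruct p as [x y]; simpl in *.
    destruct (I m ltac:(lra)) as [M|M], (I n ltac:(lra)) as [M'|M'];
      rewrite M, M' in *.
    + lra.
    + right; right; left; replace (a / 2) with x by lra; replace ((1 + b) / 2) with y by lra.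
      apply same_pt_refl.
    + left; replace ((1 + a) / 2) with x by lra; replace (b / 2) with y by lra.
      apply same_pt_refl.
    + do 3 right; left; replace ((1 + a) / 2) with x by lra.
      replace ((1 + b) / 2) with y by lra; apply same_pt_refl.
  - destruct G as [y Hy|y Hy|x Hx|x Hx]; simpl in *.
    + exfalso; apply (J (- m)%Z); rewrite opp_IZR; lra.
    + right; left; destruct (I n ltac:(lra)); [|exfalso; lra].
      replace (b / 2) with y by lra; apply same_pt_refl.
    + exfalso; apply (J (- n)%Z); rewrite opp_IZR; lra.
    + do 4 right; destruct (I m ltac:(lra)); [|exfalso; lra].
      replace (a / 2) with x by lra; apply same_pt_refl.
  - destruct G as [y Hy|y Hy|x Hx|x Hx]; simpl in *.
    + exfalso; apply (J (- m)%Z); rewrite opp_IZR; lra.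
    + right; left; destruct (I n ltac:(lra)); [|exfalso; lra].
      replace (b / 2) with y by lra; apply glue_same_pt, glue_hole_vert; lra.
    + exfalso; apply (J (- n)%Z); rewrite opp_IZR; lra.
    + do 4 right; destruct (I m ltac:(lra)); [|exfalso; lra].
      replace (a / 2) with x by lra; apply glue_same_pt, glue_hole_horiz; lra.
Qed.

Theorem theorem5p1 (a b : R) (hE : in_E a b) (p q : pt)
  (hp : regular_weierstrass a b p) (hq : regular_weierstrass a b q)
  (hpq : ~ same_pt a b p q) :
  exists (w h c d : R) (F : R -> R -> pt),
    cylinder a b w h c d F /\ core_through a b h F p /\ core_through a b h F q.
Proof.
  destruct hE as (Ha & Hb & _).
  set (W1 := fun a b : R => ((1 + a) / 2, b / 2) : pt).
  set (W2 := fun a b : R => (a, b / 2) : pt).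
  set (W3 := fun a b : R => (a / 2, (1 + b) / 2) : pt).
  set (W4 := fun a b : R => ((1 + a) / 2, (1 + b) / 2) : pt).
  set (W5 := fun a b : R => (a / 2, b) : pt).
  assert (L3 : forall a b, 0 < a < 1 -> 0 < b < 1 ->
    chart b (a / 2) ((1 + b) / 2 + 0 * (1 - b) / 2) = W3 a b)
    by (intros; apply (chart_eq _ _ _ _ 0); lra).
  assert (L5 : forall a b, 0 < a < 1 -> 0 < b < 1 ->
    chart b (a / 2) ((1 + b) / 2 + 1 * (1 - b) / 2) = W5 a b)
    by (intros; apply (chart_eq _ _ _ _ 1); lra).
  assert (L1 : forall a b, 0 < a < 1 -> 0 < b < 1 ->
    chart 0 ((1 + a) / 2) ((1 + b + 1) / 2) = W1 a b)
    by (intros; apply (chart_eq _ _ _ _ 1); lra).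
  assert (L4 : forall a b, 0 < a < 1 -> 0 < b < 1 ->
    chart 0 ((1 + a) / 2) ((1 + b + 0) / 2) = W4 a b)
    by (intros; apply (chart_eq _ _ _ _ 0); lra).
  assert (J31 : core_joined a b (W3 a b) (W1 a b))
    by (rewrite <- L3, <- L1 by auto; apply core_joined_left_right; auto).
  assert (J51 : forall a b, 0 < a < 1 -> 0 < b < 1 -> core_joined a b (W5 a b) (W1 a b))
    by (intros; rewrite <- L5, <- L1 by auto; apply core_joined_left_right; auto).
  assert (J34 : forall a b, 0 < a < 1 -> 0 < b < 1 -> core_joined a b (W3 a b) (W4 a b))
    by (intros; rewrite <- L3, <- L4 by auto; apply core_joined_left_right; auto).
  assert (J54 : forall a b, 0 < a < 1 -> 0 < b < 1 -> core_joined a b (W5 a b) (W4 a b))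
    by (intros; rewrite <- L5, <- L4 by auto; apply core_joined_left_right; auto).
  assert (J25 : core_joined a b (W2 a b) (W5 a b))
    by (rewrite <- L5 by auto; apply core_joined_sides; auto).
  assert (J21 : forall a b, 0 < a < 1 -> 0 < b < 1 -> core_joined a b (W2 a b) (W1 a b))
    by (intros; apply core_joined_horizontal; auto).
  (* The reflection exchanges [W1] with [W3] and [W2] with [W5], and fixes [W4]; this turns the six
     pairs at hand into all ten. *)
  pose proof (core_joined_swap _ _ _ _ (J51 b a Hb Ha)) as J23.
  pose proof (core_joined_swap _ _ _ _ (J34 b a Hb Ha)) as J14.
  pose proof (core_joined_swap _ _ _ _ (J54 b a Hb Ha)) as J24.
  pose proof (core_joined_swap _ _ _ _ (J21 b a Hb Ha)) as J53.
  specialize (J51 a b Ha Hb); specialize (J34 a b Ha Hb).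
  specialize (J54 a b Ha Hb); specialize (J21 a b Ha Hb).
  unfold swap in *; simpl in *.
  destruct (regular_weierstrass_cases a b p) as [Hp|[Hp|[Hp|[Hp|Hp]]]]; auto;
    destruct (regular_weierstrass_cases a b q) as [Hq|[Hq|[Hq|[Hq|Hq]]]]; auto;
    try (exfalso; apply hpq; eapply same_pt_trans; [apply same_pt_sym, Hp|exact Hq]);
    apply (core_joined_same_pt a b _ _ _ _ Hp Hq);
    first [assumption | apply core_joined_sym; assumption].
Qed.
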